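(* Let $\kappa$ be an algebraically closed field of characteristic zero, complete for a non-trivial non-Archimedean absolute value. Fix a positive integer $n$ and $\alpha_i,\beta_i\in\kappa$ ($i=1,\dots,n$) with $|\alpha_i|=1$ such that $L_i(z)=\alpha_iz+\beta_i$ is not the identity map for each $i$. For a meromorphic function $g$, let $g_1,\dots,g_m$ denote a fixed finite list of operators applied to $g$, each of the form $g\mapsto\Delta_{L_i}^jg$ for some $i\in\{1,\dots,n\}$ and positive integer $j$. Let $\Omega(X_0,\dots,X_m)=\sum_{i\in I}c_iX_0^{i_0}\cdots X_m^{i_m}$ be a non-zero polynomial with coefficients in $\mathcal{M}(\kappa)$. Let $f\in\mathcal{M}(\kappa)$ be non-constant with $$\Omega(f,f_1,\dots,f_m)=0$$ and admissible, i.e. $\sum_{i\in I}T(r,c_i)=o(T(r,f))$ as $r\to\infty$. If $a\in\mathcal{M}(\kappa)$ satisfies $T(r,a)=o(T(r,f))$ and $\Omega(a,a_1,\dots,a_m)\not\equiv0$, then $$m\!\left(r,\frac1{f-a}\right)=o(T(r,f))\quad(r\to\infty).$$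
   Context: $\mathcal{M}(\kappa)$ is the field of meromorphic functions over $\kappa$ (quotients $g/h$ of power series converging on all of $\kappa$). For entire $g=\sum a_nz^n$, $\mu(r,g)=\max_n|a_n|r^n$; $\mu(r,g/h)=\mu(r,g)/\mu(r,h)$; $m(r,F)=\log^+\mu(r,F)$; $N(r,F)=\int_0^r\frac{n(t,F)-n(0,F)}{t}dt+n(0,F)\log r$ with $n(t,F)$ the number of poles in $|z|\le t$ counted with multiplicity; $T(r,F)=m(r,F)+N(r,F)$. $\Delta_Lg=g\circ L-g$, $\Delta_L^jg=\Delta_L(\Delta_L^{j-1}g)$. *)

(* Defs.v *)
From HB Require Import structures.
From Stdlib Require Import ClassicalEpsilon.
From mathcomp Require Import all_boot all_order all_algebra.
From mathcomp Require Import all_classical all_reals all_analysis.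
Set Implicit Arguments. Unset Strict Implicit. Unset Printing Implicit Defensive.
Import Order.TTheory GRing.Theory Num.Theory.
Local Open Scope classical_set_scope.
Local Open Scope ring_scope.

Section NonArch.
Variables (K : fieldType) (R : realType) (abs : K -> R).

Definition nonarch_abs : Prop :=
  [/\ forall x, abs x = 0 <-> x = 0,
      forall x, 0 <= abs x,
      forall x y, abs (x * y) = abs x * abs y,
      forall x y, abs (x + y) <= Num.max (abs x) (abs y)
    & exists x, abs x != 0 /\ abs x != 1].

Definition cvgK (u : nat -> K) (l : K) : Prop :=
  forall e : R, 0 < e -> exists N, forall n, (N <= n)%N -> abs (u n - l) < e.

Definition cauchyK (u : nat -> K) : Prop :=
  forall e : R, 0 < e -> exists N, forall n p, (N <= n)%N -> (N <= p)%N ->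
    abs (u n - u p) < e.

Definition completeK : Prop := forall u, cauchyK u -> exists l, cvgK u l.

(** the limit of a convergent sequence (chosen arbitrarily otherwise) *)
Definition limK (u : nat -> K) : K := epsilon (inhabits 0) (cvgK u).

Definition ssum (a : nat -> K) : K := limK (fun N => \sum_(i < N) a i).

(** power series (coefficient sequences) *)
Definition ps := nat -> K.

(** the power series converges on all of K  (|a_n| r^n -> 0 for all r) *)
Definition entire (a : ps) : Prop :=
  forall r : R, 0 < r -> forall e : R, 0 < e ->
    exists N, forall n, (N <= n)%N -> abs (a n) * r ^+ n < e.

Definition ps0 : ps := fun _ => 0.
Definition ps1 : ps := fun n => if n is 0 then 1 else 0.
Definition psC (c : K) : ps := fun n => if n is 0 then c else 0.
Definition ps_add (a b : ps) : ps := fun n => a n + b n.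
Definition ps_opp (a : ps) : ps := fun n => - a n.
Definition ps_mul (a b : ps) : ps := fun n => \sum_(i < n.+1) a i * b (n - i)%N.
(** coefficients of z |-> g(al z + be) *)
Definition ps_comp_aff (al be : K) (a : ps) : ps := fun k =>
  ssum (fun n => a (n + k)%N * ('C(n + k, k))%:R * al ^+ k * be ^+ n).

Definition is_ord (g : ps) (z0 : K) (k : nat) : Prop :=
  (forall i, (i < k)%N -> ps_comp_aff 1 z0 g i = 0) /\ ps_comp_aff 1 z0 g k != 0.
Definition ord (g : ps) (z0 : K) : nat := epsilon (inhabits 0%N) (is_ord g z0).

(** meromorphic functions, represented as quotients g/h of entire functions *)
Definition mero := (ps * ps)%type.
Definition is_mero (F : mero) : Prop :=
  [/\ entire F.1, entire F.2 & exists n, F.2 n != 0].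

Definition mero_eq0 (F : mero) : Prop := forall n, F.1 n = 0.
Definition mero_eq (F G : mero) : Prop := forall n, ps_mul F.1 G.2 n = ps_mul G.1 F.2 n.
Definition mero_const (F : mero) : Prop := exists c : K, mero_eq F (psC c, ps1).

Definition mero0 : mero := (ps0, ps1).
Definition mero1 : mero := (ps1, ps1).
Definition mero_add (F G : mero) : mero :=
  (ps_add (ps_mul F.1 G.2) (ps_mul G.1 F.2), ps_mul F.2 G.2).
Definition mero_opp (F : mero) : mero := (ps_opp F.1, F.2).
Definition mero_sub (F G : mero) : mero := mero_add F (mero_opp G).
Definition mero_mul (F G : mero) : mero := (ps_mul F.1 G.1, ps_mul F.2 G.2).
Definition mero_pow (F : mero) (k : nat) : mero := iter k (mero_mul F) mero1.
Definition mero_inv (F : mero) : mero := (F.2, F.1).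
Definition mero_comp (al be : K) (F : mero) : mero :=
  (ps_comp_aff al be F.1, ps_comp_aff al be F.2).
Definition mero_delta (al be : K) (F : mero) : mero := mero_sub (mero_comp al be F) F.
Definition mero_delta_iter (al be : K) (j : nat) (F : mero) : mero :=
  iter j (mero_delta al be) F.

Definition mu_ps (r : R) (g : ps) : R := sup [set abs (g n) * r ^+ n | n in [set: nat]].
Definition mu (r : R) (F : mero) : R := mu_ps r F.1 / mu_ps r F.2.
Definition logp (x : R) : R := Num.max 0 (ln x).
Definition mprox (r : R) (F : mero) : R := logp (mu r F).

Definition pole_mult (F : mero) (z0 : K) : nat := (ord F.2 z0 - ord F.1 z0)%N.

Definition npoles (t : R) (F : mero) : R :=
  sup [set (\sum_(z <- s) pole_mult F z)%:R
        | s in [set s : seq K | uniq s /\ all (fun z => abs z <= t) s]].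

Definition Ncount (r : R) (F : mero) : R :=
  (\int[lebesgue_measure]_(t in `]0, r]) ((npoles t F - npoles 0 F) / t))
  + npoles 0 F * ln r.

Definition Tchar (r : R) (F : mero) : R := mprox r F + Ncount r F.

Definition small_o (X Y : R -> R) : Prop :=
  forall e : R, 0 < e -> exists r0 : R, forall r, r0 < r -> `|X r| <= e * Y r.

Definition ops_vars (n m : nat) (al be : 'I_n -> K)
    (oi : 'I_m -> 'I_n) (oj : 'I_m -> nat) (g : mero) : 'I_m.+1 -> mero :=
  fun k => if unlift ord0 k is Some k' then
             mero_delta_iter (al (oi k')) (be (oi k')) (oj k') g
           else g.

Definition poly_eval (m : nat) (I : finType) (c : I -> mero) (e : I -> 'I_m.+1 -> nat)
    (X : 'I_m.+1 -> mero) : mero :=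
  \big[mero_add/mero0]_(i : I)
     mero_mul (c i) (\big[mero_mul/mero1]_(k < m.+1) mero_pow (X k) (e i k)).

End NonArch.

(* Main.v *)
(** Write [mu r] for the Gauss norm of radius [r], extended to quotients, and
    let [D = mu r (f - a)].  For large [r] the operators [Delta_L] do not
    increase [mu r], so replacing [f] by [a] in every monomial changes its
    value by at most [D] times the norms of the coefficients and of [a]; since
    [Omega(f) = 0], this gives [mu r (Omega(a)) <= B r * D] whenever [D <= 1],
    with [log B = o(T(r, f))].  It remains to bound [mu r (Omega(a))] from
    below.  Jensen's formula [log mu r h = sum over zeros (log r - log |z|) + C]
    for entire [h] shows that [- log mu r (Omega(a))] is at most the counting
    function of the poles of [Omega(a)], and these are controlled by the poles
    of the coefficients and of [a], whose counting functions are [o(T(r, f))].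
    Jensen's formula itself follows by splitting off the zeros in the disc:
    the Gauss norm is multiplicative, the rightmost vertex of the Newton
    polygon is additive, and a positive vertex index forces a zero. *)
Require Import Defs.
From HB Require Import structures.
From mathcomp Require Import all_boot all_order all_algebra.
From mathcomp Require Import all_classical all_reals all_analysis.
From mathcomp Require Import ring lra zify.
Set Implicit Arguments. Unset Strict Implicit. Unset Printing Implicit Defensive.
Import Order.TTheory GRing.Theory Num.Theory.
Local Open Scope ring_scope.

(** * The ring of power series and the Gauss norm *)

(** Two features of the encoding shape the proof. Meromorphic functions are unreduced pairs, so
    numerator and denominator may share zeros. Smallness is therefore carried by a bound on the
    Gauss norm together with a weight dominating the pole orders, a form stable under sums, products
    and affine substitution. Affine substitution is defined coefficientwise by infinite sums; its
    compatibility with products and composition is obtained from the polynomial case by density,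
    without double series.

    The factor [B r] does not depend on [f]: when D <= 1 the ultrametric inequality gives mu r f <=
    max(1, mu r a), and since [Delta_L] is non-expanding for large [r], this one bound serves for
    every variable of Omega. When D > 1 the proximity function is simply 0. Additive constants, such
    as the one in Jensen's formula, are absorbed because T(r, f) tends to infinity, and this is
    where the non-constancy of [f] enters. *)

Section PowerSeriesRing.
Variable K : fieldType.

Definition psp (p : {poly K}) : ps K := fun n => p`_n.
Definition trunc (N : nat) (a : ps K) : {poly K} := \poly_(i < N) a i.

Lemma psp_mul p q : psp (p * q) = ps_mul (psp p) (psp q).
Proof. by apply/funext => n; rewrite /psp /ps_mul coefM. Qed.

Lemma psp0 : psp 0 = ps0 K.
Proof. by apply/funext => n; rewrite /psp coef0. Qed.

Lemma psp1 : psp 1 = ps1 K.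
Proof. by apply/funext => -[|n]; rewrite /psp coef1. Qed.

Lemma pspC c : psp c%:P = psC c.
Proof. by apply/funext => -[|n]; rewrite /psp coefC. Qed.

(** A coefficient of a product sees only finitely many coefficients of the factors; this transfers
    the ring laws from polynomials. *)
Lemma ps_mul_trunc N a b n : (n < N)%N ->
  ps_mul a b n = (trunc N a * trunc N b)`_n.
Proof.
move=> nN; rewrite coefM; apply: eq_bigr => i _.
have iN : (i < N)%N by apply: leq_ltn_trans nN; rewrite -ltnS.
have niN : (n - i < N)%N by apply: leq_ltn_trans nN; apply: leq_subr.
by rewrite !coef_poly iN niN.
Qed.

Lemma ps_mulC a b : ps_mul a b = ps_mul b a :> ps K.
Proof.
by apply/funext => n; rewrite !(ps_mul_trunc _ _ (ltnSn n)) mulrC.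
Qed.

Lemma ps_mulA a b c : ps_mul a (ps_mul b c) = ps_mul (ps_mul a b) c :> ps K.
Proof.
apply/funext => n.
have -> : ps_mul a (ps_mul b c) n =
    (trunc n.+1 a * (trunc n.+1 b * trunc n.+1 c))`_n.
  rewrite coefM; apply: eq_bigr => i _.
  rewrite coef_poly ltn_ord; congr (_ * _).
  by apply: ps_mul_trunc; rewrite ltnS leq_subr.
rewrite mulrA coefM; apply: eq_bigr => i _.
by rewrite -(ps_mul_trunc _ _ (ltn_ord i)) coef_poly ltnS leq_subr.
Qed.

Lemma ps_mulDl a b c : ps_mul (ps_add a b) c = ps_add (ps_mul a c) (ps_mul b c) :> ps K.
Proof.
apply/funext => n; rewrite /ps_add /ps_mul -big_split /=.
by apply: eq_bigr => i _; rewrite mulrDl.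
Qed.

Lemma ps_mul1 a : ps_mul (ps1 K) a = a.
Proof.
apply/funext => n; rewrite /ps_mul big_ord_recl big1 /= ?subn0 ?mul1r ?addr0 //.
by move=> i _; rewrite /= mul0r.
Qed.

(* A record, because [ps K] unfolds to [nat -> K], which already carries
   pointwise ring structures. *)
Record fps := Fps { coefs : ps K }.

HB.instance Definition _ := gen_eqMixin fps.
HB.instance Definition _ := gen_choiceMixin fps.

Let fadd (x y : fps) := Fps (ps_add (coefs x) (coefs y)).
Let fopp (x : fps) := Fps (ps_opp (coefs x)).
Let fmul (x y : fps) := Fps (ps_mul (coefs x) (coefs y)).

Let faddA : associative fadd.
Proof. by move=> x y z; congr Fps; apply/funext => n; rewrite /= /ps_add addrA. Qed.
Let faddC : commutative fadd.
Proof. by move=> x y; congr Fps; apply/funext => n; rewrite /= /ps_add addrC. Qed.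
Let fadd0 : left_id (Fps (ps0 K)) fadd.
Proof. by case=> x; congr Fps; apply/funext => n; rewrite /= /ps_add add0r. Qed.
Let faddN : left_inverse (Fps (ps0 K)) fopp fadd.
Proof. by move=> x; congr Fps; apply/funext => n; rewrite /= /ps_add /ps_opp addNr. Qed.

HB.instance Definition _ := GRing.isZmodule.Build fps faddA faddC fadd0 faddN.

Let fmulA : associative fmul.
Proof. by move=> x y z; rewrite /fmul /= ps_mulA. Qed.
Let fmulC : commutative fmul.
Proof. by move=> x y; rewrite /fmul /= ps_mulC. Qed.
Let fmul1 : left_id (Fps (ps1 K)) fmul.
Proof. by case=> x; rewrite /fmul /= ps_mul1. Qed.
Let fmulDl : left_distributive fmul +%R.
Proof. by move=> x y z; congr Fps; rewrite /= ps_mulDl. Qed.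

HB.instance Definition _ := GRing.Zmodule_isComPzRing.Build fps fmulA fmulC fmul1 fmulDl.

Lemma ps_mulNl (a b : ps K) : ps_mul (ps_opp a) b = ps_opp (ps_mul a b).
Proof. by have /(congr1 coefs) := mulNr (Fps a) (Fps b). Qed.

End PowerSeriesRing.

(** * Ultrametric inequalities *)

Section AbsoluteValue.
Variables (K : fieldType) (R : realType) (abs : K -> R).
Hypothesis Habs : nonarch_abs abs.

Lemma absP0 x : abs x = 0 <-> x = 0. Proof. by case: Habs. Qed.
Lemma abs_ge0 x : 0 <= abs x. Proof. by case: Habs. Qed.
Lemma absM : {morph abs : x y / x * y}. Proof. by case: Habs. Qed.
Lemma absD x y : abs (x + y) <= Num.max (abs x) (abs y). Proof. by case: Habs. Qed.
Lemma abs0 : abs 0 = 0. Proof. exact/absP0. Qed.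

Lemma abs_eq0 x : (abs x == 0) = (x == 0).
Proof. by apply/eqP/eqP => /absP0. Qed.

Lemma abs_gt0 x : (0 < abs x) = (x != 0).
Proof. by rewrite lt_def abs_ge0 andbT abs_eq0. Qed.

Lemma abs1 : abs 1 = 1.
Proof.
have n0 : abs 1 != 0 by rewrite abs_eq0 oner_eq0.
by apply: (mulfI n0); rewrite -absM !mulr1.
Qed.

Lemma absN x : abs (- x) = abs x.
Proof.
have : (abs (- x)) ^+ 2 = (abs x) ^+ 2 by rewrite !expr2 -!absM mulrNN.
by move/eqP; rewrite eqrXn2 ?abs_ge0 // => /eqP.
Qed.

Lemma absB x y : abs (x - y) = abs (y - x).
Proof. by rewrite -absN opprB. Qed.

Lemma absX x n : abs (x ^+ n) = abs x ^+ n.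
Proof. by elim: n => [|n IH]; rewrite ?expr0 ?abs1 // !exprS absM IH. Qed.

Lemma absD_le M x y : abs x <= M -> abs y <= M -> abs (x + y) <= M.
Proof. by move=> xM yM; apply: le_trans (absD x y) _; rewrite ge_max xM. Qed.

Lemma absD_lt M x y : abs x < M -> abs y < M -> abs (x + y) < M.
Proof. by move=> xM yM; apply: le_lt_trans (absD x y) _; rewrite gt_max xM. Qed.

(** Isosceles triangle principle: otherwise [x], being the difference of [x + y] and [y], would be
    smaller than itself. *)
Lemma absD_dom x y : abs y < abs x -> abs (x + y) = abs x.
Proof.
move=> yx; apply/eqP; rewrite eq_le; apply/andP; split; first by rewrite absD_le ?lexx ?ltW.
rewrite leNgt; apply/negP => lt.
have : abs (x + y - y) < abs x by apply: absD_lt; rewrite ?absN.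
by rewrite addrK ltxx.
Qed.

Lemma abs_sum_le (I : Type) (s : seq I) (P : pred I) (F : I -> K) M : 0 <= M ->
  (forall i, P i -> abs (F i) <= M) -> abs (\sum_(i <- s | P i) F i) <= M.
Proof.
by move=> M0 FM; elim/big_ind: _ => //; [rewrite abs0 | move=> x y; apply: absD_le].
Qed.

Lemma abs_sum_lt (I : Type) (s : seq I) (P : pred I) (F : I -> K) M : 0 < M ->
  (forall i, P i -> abs (F i) < M) -> abs (\sum_(i <- s | P i) F i) < M.
Proof.
by move=> M0 FM; elim/big_ind: _ => //; [rewrite abs0 | move=> x y; apply: absD_lt].
Qed.

Lemma abs_natr n : abs n%:R <= 1.
Proof.
elim: n => [|n IH]; first by rewrite abs0 ler01.
by rewrite -natr1 absD_le // abs1.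
Qed.

Lemma abs_prod (I : Type) (s : seq I) (F : I -> K) :
  abs (\prod_(i <- s) F i) = \prod_(i <- s) abs (F i).
Proof. by elim/big_rec2: _ => [|i x y _ <-]; rewrite ?abs1 ?absM. Qed.

Lemma absV1 x : abs x = 1 -> x != 0 /\ abs x^-1 = 1.
Proof.
move=> x1; have x0 : x != 0 by rewrite -abs_gt0 x1.
by split=> //; have := abs1; rewrite -(mulfV x0) absM x1 mul1r.
Qed.

End AbsoluteValue.

(** * Gauss norm and Newton polygon of an entire function *)

Section GaussNorm.
Variables (K : fieldType) (R : realType) (abs : K -> R).
Hypothesis Habs : nonarch_abs abs.
Implicit Types (g h : ps K) (r M : R).

Let abs_ge0' := abs_ge0 Habs.
Hint Resolve abs_ge0' : core.

Lemma term_ge0 g r n : 0 < r -> 0 <= abs (g n) * r ^+ n.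
Proof. by move=> r0; rewrite mulr_ge0 // exprn_ge0 // ltW. Qed.

(** The terms tend to 0, so beyond some index all lie below one fixed non-zero term. The supremum in
    [mu_ps] is thus a maximum. *)
Lemma entire_max g r : entire abs g -> 0 < r ->
  exists n, forall m, abs (g m) * r ^+ m <= abs (g n) * r ^+ n.
Proof.
move=> Eg r0; have [/existsNP [n0 gn0]|/contrapT g0] := pselect (~ forall n, g n = 0); last first.
  by exists 0%N => m; rewrite !g0 (abs0 Habs) !mul0r.
have e0 : 0 < abs (g n0) * r ^+ n0.
  by rewrite mulr_gt0 ?exprn_gt0 // (abs_gt0 Habs); apply/eqP.
have [N HN] := Eg r r0 _ e0.
pose F (i : 'I_(maxn N n0).+1) := abs (g i) * r ^+ i.
have n0b : (n0 < (maxn N n0).+1)%N by rewrite ltnS leq_maxr.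
have [i _ Hi] := @arg_maxP _ _ _ (Ordinal n0b) predT F isT.
exists i => m; have [mN|mN] := ltnP m (maxn N n0).+1.
  exact: (Hi (Ordinal mN) isT).
apply: le_trans (Hi (Ordinal n0b) isT); apply/ltW/HN.
by apply: leq_trans (ltnW mN); rewrite leq_maxl.
Qed.

Lemma mu_ps_ub g r n : entire abs g -> 0 < r ->
  abs (g n) * r ^+ n <= mu_ps abs r g.
Proof.
move=> Eg r0; have [k Hk] := entire_max Eg r0.
apply: ub_le_sup; last by exists n.
by exists (abs (g k) * r ^+ k) => _ [m _ <-].
Qed.

Lemma mu_ps_le g r M : (forall n, abs (g n) * r ^+ n <= M) -> mu_ps abs r g <= M.
Proof.
move=> gM; apply: ge_sup => [|_ [n _ <-]//].
by exists (abs (g 0%N) * r ^+ 0), 0%N.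
Qed.

Lemma mu_ps_attained g r : entire abs g -> 0 < r ->
  exists n, mu_ps abs r g = abs (g n) * r ^+ n.
Proof.
move=> Eg r0; have [k Hk] := entire_max Eg r0; exists k.
by apply/eqP; rewrite eq_le mu_ps_ub // mu_ps_le.
Qed.

Lemma mu_ps_lt g r M : entire abs g -> 0 < r ->
  (forall n, abs (g n) * r ^+ n < M) -> mu_ps abs r g < M.
Proof. by move=> Eg r0 gM; have [k ->] := mu_ps_attained Eg r0. Qed.

Lemma mu_ps_ge0 g r : entire abs g -> 0 < r -> 0 <= mu_ps abs r g.
Proof. by move=> Eg r0; apply: le_trans (mu_ps_ub 0 Eg r0); apply: term_ge0. Qed.

Lemma mu_ps_gt0 g r n : entire abs g -> 0 < r -> g n != 0 -> 0 < mu_ps abs r g.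
Proof.
move=> Eg r0 gn; apply: lt_le_trans (mu_ps_ub n Eg r0).
by rewrite mulr_gt0 ?exprn_gt0 ?(abs_gt0 Habs).
Qed.

Lemma mu_ps_eq0 g r : entire abs g -> 0 < r -> mu_ps abs r g = 0 -> g = ps0 K.
Proof.
move=> Eg r0 mu0; apply/funext => n; apply/eqP/negPn/negP => gn.
by have := mu_ps_gt0 Eg r0 gn; rewrite mu0 ltxx.
Qed.

Lemma abs_coef_le g r n : entire abs g -> 0 < r -> abs (g n) <= mu_ps abs r g / r ^+ n.
Proof. by move=> Eg r0; rewrite ler_pdivlMr ?exprn_gt0 // mu_ps_ub. Qed.

Lemma psp_entire (p : {poly K}) : entire abs (psp p).
Proof.
move=> r r0 e e0; exists (size p) => n pn.
by rewrite /psp nth_default // (abs0 Habs) mul0r.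
Qed.

Lemma ps0_entire : entire abs (ps0 K).
Proof. by rewrite -psp0; apply: psp_entire. Qed.

Lemma ps1_entire : entire abs (ps1 K).
Proof. by rewrite -psp1; apply: psp_entire. Qed.

Lemma ps_add_entire g h : entire abs g -> entire abs h -> entire abs (ps_add g h).
Proof.
move=> Eg Eh r r0 e e0; have [N HN] := Eg r r0 e e0; have [P HP] := Eh r r0 e e0.
exists (maxn N P) => n; rewrite geq_max => /andP[Nn Pn].
have rn : 0 < r ^+ n by rewrite exprn_gt0.
rewrite -ltr_pdivlMr //; apply: (absD_lt Habs); rewrite ltr_pdivlMr //.
  exact: HN.
exact: HP.
Qed.

Lemma ps_opp_entire g : entire abs g -> entire abs (ps_opp g).
Proof.
move=> Eg r r0 e e0; have [N HN] := Eg r r0 e e0; exists N => n Nn.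
by rewrite /ps_opp (absN Habs); apply: HN.
Qed.

Let expr_subnKC r n i : (i <= n)%N -> r ^+ i * r ^+ (n - i) = r ^+ n.
Proof. by move=> il; rewrite -exprD subnKC. Qed.

Lemma term_mul_le g h r n M : 0 < r -> 0 <= M ->
  (forall i, (i <= n)%N -> (abs (g i) * r ^+ i) * (abs (h (n - i)%N) * r ^+ (n - i)) <= M) ->
  abs (ps_mul g h n) * r ^+ n <= M.
Proof.
move=> r0 M0 H; have rn : 0 < r ^+ n by rewrite exprn_gt0.
rewrite -ler_pdivlMr //; apply: (abs_sum_le Habs); first by rewrite divr_ge0 // ltW.
move=> i _; rewrite ler_pdivlMr // (absM Habs).
have il : (i <= n)%N by rewrite -ltnS.
by apply: le_trans (H i il); rewrite -(expr_subnKC r il) mulrACA.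
Qed.

Lemma term_mul_lt g h r n M : 0 < r -> 0 < M ->
  (forall i, (i <= n)%N -> (abs (g i) * r ^+ i) * (abs (h (n - i)%N) * r ^+ (n - i)) < M) ->
  abs (ps_mul g h n) * r ^+ n < M.
Proof.
move=> r0 M0 H; have rn : 0 < r ^+ n by rewrite exprn_gt0.
rewrite -ltr_pdivlMr //; apply: (abs_sum_lt Habs); first by rewrite divr_gt0.
move=> i _; rewrite ltr_pdivlMr // (absM Habs).
have il : (i <= n)%N by rewrite -ltnS.
by apply: le_lt_trans (H i il); rewrite -(expr_subnKC r il) mulrACA.
Qed.

Lemma ps_mul_entire g h : entire abs g -> entire abs h -> entire abs (ps_mul g h).
Proof.
move=> Eg Eh r r0 e e0.
pose G := mu_ps abs r g + 1; pose H := mu_ps abs r h + 1.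
have G0 : 0 < G by rewrite ltr_wpDl ?mu_ps_ge0.
have H0 : 0 < H by rewrite ltr_wpDl ?mu_ps_ge0.
have [N HN] := Eg r r0 (e / H) (divr_gt0 e0 H0).
have [P HP] := Eh r r0 (e / G) (divr_gt0 e0 G0).
exists (N + P)%N => n NPn; apply: term_mul_lt => // i il.
have [Ni|iN] := leqP N i.
  apply: le_lt_trans (_ : _ <= (abs (g i) * r ^+ i) * H) _; last by rewrite -ltr_pdivlMr ?HN.
  rewrite ler_wpM2l ?term_ge0 //; apply: le_trans (mu_ps_ub _ Eh r0) _.
  by rewrite lerDl.
apply: le_lt_trans (_ : _ <= G * (abs (h (n - i)%N) * r ^+ (n - i))) _.
  rewrite ler_wpM2r ?term_ge0 //; apply: le_trans (mu_ps_ub _ Eg r0) _.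
  by rewrite lerDl.
rewrite mulrC -ltr_pdivlMr ?HP //.
lia.
Qed.

(* [k] is the rightmost vertex index of the Newton polygon at radius [r],
   i.e. the number of zeros in the closed disc. *)
Definition top_index r g k :=
  abs (g k) * r ^+ k = mu_ps abs r g /\
  forall n, (k < n)%N -> abs (g n) * r ^+ n < mu_ps abs r g.

Lemma top_index_exists g r n : entire abs g -> 0 < r -> g n != 0 ->
  exists k, top_index r g k.
Proof.
move=> Eg r0 gn; have mu0 := mu_ps_gt0 Eg r0 gn.
have [N HN] := Eg r r0 _ mu0.
have ex : exists k, abs (g k) * r ^+ k == mu_ps abs r g.
  by have [k Hk] := mu_ps_attained Eg r0; exists k; rewrite Hk.
have ub k : abs (g k) * r ^+ k == mu_ps abs r g -> (k <= N)%N.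
  move=> /eqP E; rewrite leqNgt; apply/negP => Nk.
  by have := HN k (ltnW Nk); rewrite E ltxx.
case: (ex_maxnP ex ub) => k /eqP Ek maxk; exists k; split => // i ki.
rewrite lt_def mu_ps_ub // andbT; apply/negP; rewrite eq_sym => /maxk.
by rewrite leqNgt ki.
Qed.

Lemma top_index_neq0 g r k : entire abs g -> 0 < r -> top_index r g k ->
  0 < mu_ps abs r g.
Proof.
move=> Eg r0 [_ /(_ _ (ltnSn k))]; apply: le_lt_trans; exact: term_ge0.
Qed.

(** Gauss's lemma: in the coefficient of index [k + l] the term from [g k * h l] strictly dominates,
    because every other pair of indices exceeds [k] or [l] on one side. The same strictness covers
    all indices beyond [k + l]. *)
Lemma top_index_mul g h r k l : entire abs g -> entire abs h -> 0 < r ->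
  top_index r g k -> top_index r h l ->
  mu_ps abs r (ps_mul g h) = mu_ps abs r g * mu_ps abs r h /\
  top_index r (ps_mul g h) (k + l).
Proof.
move=> Eg Eh r0 tg th.
have g0 := top_index_neq0 Eg r0 tg; have h0 := top_index_neq0 Eh r0 th.
move: tg th => [gk gn] [hl hn].
have gh0 : 0 < mu_ps abs r g * mu_ps abs r h by rewrite mulr_gt0.
have strict n i : (i <= n)%N -> (k < i)%N || (l < n - i)%N ->
    (abs (g i) * r ^+ i) * (abs (h (n - i)%N) * r ^+ (n - i)) <
    mu_ps abs r g * mu_ps abs r h.
  move=> il /orP[ki|li].
    apply: le_lt_trans (_ : _ <= abs (g i) * r ^+ i * mu_ps abs r h) _.
      by rewrite ler_wpM2l ?term_ge0 ?mu_ps_ub.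
    by rewrite ltr_pM2r ?gn.
  apply: le_lt_trans (_ : _ <= mu_ps abs r g * (abs (h (n - i)%N) * r ^+ (n - i))) _.
    by rewrite ler_wpM2r ?term_ge0 ?mu_ps_ub.
  by rewrite ltr_pM2l ?hn.
have Ekl : abs (ps_mul g h (k + l)%N) * r ^+ (k + l) = mu_ps abs r g * mu_ps abs r h.
  have kkl : (k < (k + l).+1)%N by rewrite ltnS leq_addr.
  rewrite /ps_mul (bigD1 (Ordinal kkl)) //= addKn (absD_dom Habs).
    by rewrite (absM Habs) exprD mulrACA gk hl.
  have rn : 0 < r ^+ (k + l) by rewrite exprn_gt0.
  have E : abs (g k * h l) = mu_ps abs r g * mu_ps abs r h / r ^+ (k + l).
    by rewrite -gk -hl mulrACA -exprD mulfK ?gt_eqF // (absM Habs).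
  rewrite E; apply: (abs_sum_lt Habs); first by rewrite divr_gt0.
  move=> i ik; rewrite ltr_pdivlMr // (absM Habs).
  have il : (i <= k + l)%N by rewrite -ltnS.
  apply: le_lt_trans (strict (k + l)%N i il _).
    by rewrite -(expr_subnKC r il) mulrACA.
  have : (i : nat) != k by apply: contraNneq ik => ik; apply/eqP/val_inj.
  lia.
have Emu : mu_ps abs r (ps_mul g h) = mu_ps abs r g * mu_ps abs r h.
  apply/eqP; rewrite eq_le; apply/andP; split; last first.
    by rewrite -Ekl; apply: mu_ps_ub => //; apply: ps_mul_entire.
  apply: mu_ps_le => n; apply: term_mul_le => [//||i il]; first exact: ltW.
  by rewrite ler_pM ?term_ge0 ?mu_ps_ub.
split=> //; split; first by rewrite Emu Ekl.
move=> n kln; rewrite Emu; apply: term_mul_lt => // i il; apply: strict => //.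
lia.
Qed.

Lemma mu_psN r g : mu_ps abs r (ps_opp g) = mu_ps abs r g.
Proof.
rewrite /mu_ps; congr sup; apply/seteqP; split=> _ [n _ <-]; exists n => //;
by rewrite /ps_opp (absN Habs).
Qed.

Lemma mu_ps0 r : mu_ps abs r (ps0 K) = 0.
Proof.
rewrite /mu_ps (_ : [set _ | _ in _] = [set 0])%classic ?sup1 //.
apply/seteqP; split => [_ [n _ <-]|_ ->]; first by rewrite (abs0 Habs) mul0r.
by exists 0%N; rewrite // (abs0 Habs) mul0r.
Qed.

Lemma ps_neq0 g : g <> ps0 K -> exists n, g n != 0.
Proof.
move=> g0; have [/existsNP[n /eqP gn]|/contrapT g0'] := pselect (~ forall n, g n = 0).
  by exists n.
by exfalso; apply: g0; apply/funext.
Qed.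

Lemma mu_psM g h r : entire abs g -> entire abs h -> 0 < r ->
  mu_ps abs r (ps_mul g h) = mu_ps abs r g * mu_ps abs r h.
Proof.
move=> Eg Eh r0.
have mul0 x : ps_mul (ps0 K) x = ps0 K.
  by apply/funext => n; rewrite /ps_mul big1 // => i _; rewrite mul0r.
have [->|/ps_neq0[i gi]] := pselect (g = ps0 K); first by rewrite mul0 !mu_ps0 mul0r.
have [->|/ps_neq0[j hj]] := pselect (h = ps0 K).
  by rewrite ps_mulC mul0 !mu_ps0 mulr0.
have [k gk] := top_index_exists Eg r0 gi; have [l hl] := top_index_exists Eh r0 hj.
by have [] := top_index_mul Eg Eh r0 gk hl.
Qed.

Lemma mu_psD_le M g h r : entire abs g -> entire abs h -> 0 < r ->
  mu_ps abs r g <= M -> mu_ps abs r h <= M -> mu_ps abs r (ps_add g h) <= M.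
Proof.
move=> Eg Eh r0 gM hM; apply: mu_ps_le => n.
have rn : 0 < r ^+ n by rewrite exprn_gt0.
rewrite -ler_pdivlMr //; apply: (absD_le Habs); rewrite ler_pdivlMr //.
  exact: le_trans (mu_ps_ub n Eg r0) gM.
exact: le_trans (mu_ps_ub n Eh r0) hM.
Qed.

Lemma ps_mul_eq0 g h : entire abs g -> entire abs h -> ps_mul g h = ps0 K ->
  g = ps0 K \/ h = ps0 K.
Proof.
move=> Eg Eh gh; have /eqP := mu_psM Eg Eh (@ltr01 R).
rewrite gh mu_ps0 eq_sym mulf_eq0 => /orP[]/eqP /mu_ps_eq0 E; [left|right]; exact: E.
Qed.

End GaussNorm.

(** * Affine substitution *)

Section Substitution.
Variables (K : fieldType) (R : realType) (abs : K -> R).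
Hypotheses (Habs : nonarch_abs abs) (Hcomplete : completeK abs).
Implicit Types (g h : ps K) (r M : R) (a b : nat -> K).

Let abs_ge0' := abs_ge0 Habs.
Hint Resolve abs_ge0' : core.

Lemma cvgK_unique (u : nat -> K) l l' : cvgK abs u l -> cvgK abs u l' -> l = l'.
Proof.
move=> ul ul'; apply/eqP; rewrite -subr_eq0; apply/negPn/negP.
rewrite -(abs_gt0 Habs) => e0.
have [N HN] := ul _ e0; have [P HP] := ul' _ e0.
have := HN (maxn N P) (leq_maxl _ _); have := HP (maxn N P) (leq_maxr _ _).
set x := u _ => xl' xl; suff: abs (l - l') < abs (l - l') by rewrite ltxx.
rewrite {1}(_ : l - l' = (l - x) + (x - l')); last by ring.
by apply: (absD_lt Habs) => //; rewrite (absB Habs).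
Qed.

Lemma limKP (u : nat -> K) l : cvgK abs u l -> limK abs u = l.
Proof.
move=> ul; apply: (cvgK_unique _ ul).
exact: (ClassicalEpsilon.epsilon_spec (inhabits 0) (cvgK abs u) (ex_intro _ l ul)).
Qed.

Lemma sum_ordB a p q : (p <= q)%N ->
  \sum_(i < q) a i - \sum_(i < p) a i = \sum_(p <= i < q) a i.
Proof.
move=> pq; rewrite -(big_mkord xpredT a) (big_cat_nat (leq0n p) pq) big_mkord /=.
by rewrite addrAC subrr add0r.
Qed.

Definition null a := forall e : R, 0 < e ->
  exists N, forall n, (N <= n)%N -> abs (a n) < e.

(** In an ultrametric field a block of small terms has a small sum, so null terms already make the
    partial sums Cauchy. *)
Lemma ssum_cvg a : null a -> cvgK abs (fun N => \sum_(i < N) a i) (ssum abs a).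
Proof.
move=> a0.
have [l Hl] : exists l, cvgK abs (fun N => \sum_(i < N) a i) l.
  apply: Hcomplete => e e0; have [N HN] := a0 e e0; exists N.
  have H p q : (N <= p)%N -> (p <= q)%N ->
      abs (\sum_(i < q) a i - \sum_(i < p) a i) < e.
    move=> Np pq; rewrite sum_ordB // big_nat; apply: (abs_sum_lt Habs) => // i /andP[pi _].
    exact: HN (leq_trans Np pi).
  move=> n p Nn Np; have [np|pn] := leqP n p; last exact: H (ltnW pn).
  by rewrite (absB Habs); apply: H.
by rewrite /ssum (limKP Hl).
Qed.

Lemma ssum_add a b : null a -> null b ->
  ssum abs (fun n => a n + b n) = ssum abs a + ssum abs b.
Proof.
move=> a0 b0; apply: limKP => e e0.
have [N HN] := ssum_cvg a0 e0; have [P HP] := ssum_cvg b0 e0.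
exists (maxn N P) => n; rewrite geq_max => /andP[Nn Pn].
rewrite big_split /= opprD addrACA.
by apply: (absD_lt Habs); [apply: HN | apply: HP].
Qed.

Lemma ssum_fin a N : (forall n, (N <= n)%N -> a n = 0) ->
  ssum abs a = \sum_(i < N) a i.
Proof.
move=> a0; apply: limKP => e e0; exists N => n Nn.
rewrite sum_ordB // big_nat big1 ?(abs0 Habs) // => i /andP[Ni _]; exact: a0.
Qed.

Lemma ssum_le a M : null a -> (forall n, abs (a n) <= M) -> abs (ssum abs a) <= M.
Proof.
move=> a0 aM; have M0 : 0 <= M by apply: le_trans (aM 0%N).
apply/ler_addgt0Pl => e e0; have [N HN] := ssum_cvg a0 e0.
have := HN N (leqnn N); set s := \sum_(i < N) _; set t := ssum _ _ => st.
have sM : abs s <= M by apply: (abs_sum_le Habs).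
rewrite -(subrK s t); apply: (absD_le Habs).
  by rewrite (absB Habs) ltW // (lt_le_trans st) // lerDl.
by rewrite (le_trans sM) // lerDr ltW.
Qed.

Section Affine.
Variables (al be : K).
Hypothesis Hal : abs al = 1.
Local Notation psi := (ps_comp_aff abs al be).

Lemma comp_term_le g k n r : 0 < r -> abs be <= r ->
  abs (g (n + k)%N * ('C(n + k, k))%:R * al ^+ k * be ^+ n) * r ^+ k
    <= abs (g (n + k)%N) * r ^+ (n + k).
Proof.
move=> r0 ber; rewrite !(absM Habs) !(absX Habs) Hal expr1n mulr1 exprD mulrA.
apply: ler_wpM2r; first by rewrite exprn_ge0 // ltW.
rewrite -mulrA; apply: ler_wpM2l => //.
rewrite -[leRHS]mul1r; apply: ler_pM; rewrite ?exprn_ge0 ?(abs_natr Habs) //.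
by rewrite lerXn2r ?nnegrE ?(ltW r0).
Qed.

Lemma comp_null g k : entire abs g ->
  null (fun n => g (n + k)%N * ('C(n + k, k))%:R * al ^+ k * be ^+ n).
Proof.
move=> Eg e e0; pose r := Num.max 1 (abs be).
have r1 : 1 <= r by rewrite /r le_max lexx.
have r0 : 0 < r by apply: lt_le_trans r1.
have ber : abs be <= r by rewrite /r le_max lexx orbT.
have [N HN] := Eg r r0 e e0; exists N => n Nn.
apply: le_lt_trans (HN (n + k)%N (leq_trans Nn (leq_addr _ _))).
apply: le_trans (comp_term_le g k n r0 ber).
by rewrite ler_peMr // exprn_ege1.
Qed.

(** Coefficient [k] of the substituted series involves only the coefficients of [g] from [k] on.
    Bounding just this tail yields both convergence ([comp_entire]) and the norm bound
    ([comp_mu_le]). *)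
Lemma comp_coef_le g k r M : entire abs g -> 0 < r -> abs be <= r ->
  (forall n, (k <= n)%N -> abs (g n) * r ^+ n <= M) -> abs (psi g k) * r ^+ k <= M.
Proof.
move=> Eg r0 ber gM; have rk : 0 < r ^+ k by rewrite exprn_gt0.
rewrite -ler_pdivlMr //; apply: ssum_le; first exact: comp_null.
move=> n; rewrite ler_pdivlMr //; apply: le_trans (gM (n + k)%N (leq_addl _ _)).
exact: comp_term_le.
Qed.

Lemma comp_entire g : entire abs g -> entire abs (psi g).
Proof.
move=> Eg r r0 e e0; pose r' := Num.max r (abs be).
have rr : r <= r' by rewrite /r' le_max lexx.
have r0' : 0 < r' by apply: lt_le_trans rr.
have ber : abs be <= r' by rewrite /r' le_max lexx orbT.
have [N HN] := Eg r' r0' (e / 2) (divr_gt0 e0 (ltr0n _ 2)); exists N => k Nk.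
have : abs (psi g k) * r' ^+ k <= e / 2.
  by apply: comp_coef_le => // n kn; apply/ltW/HN/(leq_trans Nk).
move=> H; apply: le_lt_trans (le_lt_trans H _); last by lra.
by apply: ler_wpM2l => //; rewrite lerXn2r ?nnegrE ?(ltW r0) ?(ltW r0') //.
Qed.

Lemma comp_mu_le g r : entire abs g -> 0 < r -> abs be <= r ->
  mu_ps abs r (psi g) <= mu_ps abs r g.
Proof.
move=> Eg r0 ber; apply: mu_ps_le => k; apply: comp_coef_le => // n _.
exact: mu_ps_ub.
Qed.

Lemma comp_add g h : entire abs g -> entire abs h ->
  psi (ps_add g h) = ps_add (psi g) (psi h).
Proof.
move=> Eg Eh; apply/funext => k; rewrite /ps_add /ps_comp_aff.
rewrite -ssum_add; try exact: comp_null.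
by congr ssum; apply/funext => n; rewrite !mulrDl.
Qed.

Lemma coef_affX i k : (((al%:P * 'X + be%:P) ^+ i)`_k =
  if (k <= i)%N then ('C(i, k))%:R * al ^+ k * be ^+ (i - k) else 0).
Proof.
rewrite addrC exprDn coef_sum.
have term (j : 'I_i.+1) : (be%:P ^+ (i - j) * (al%:P * 'X) ^+ j *+ 'C(i, j))`_k =
    (be ^+ (i - j) * al ^+ j *+ 'C(i, j)) * (k == j)%:R.
  by rewrite coefMn exprMn -!rmorphXn /= coefCM coefCM coefXn mulrnAl mulrA.
rewrite (eq_bigr _ (fun j _ => term j)).
have [ki|ik] := leqP k i.
  have kl : (k < i.+1)%N by rewrite ltnS.
  rewrite (bigD1 (Ordinal kl)) //= eqxx mulr1 big1 ?addr0 => [|j jk].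
    by rewrite -mulr_natr; ring.
  rewrite eq_sym; case: eqP => [jk'|]; last by rewrite mulr0.
  by case/eqP: jk; apply/val_inj.
rewrite big1 // => j _; case: eqP => [kj|]; last by rewrite mulr0.
by have := ltn_ord j; rewrite -kj ltnS leqNgt ik.
Qed.

Lemma comp_psp (p : {poly K}) : psi (psp p) = psp (p \Po (al%:P * 'X + be%:P)).
Proof.
apply/funext => k; rewrite {2}/psp comp_polyE coef_sum.
under eq_bigr do rewrite coefZ coef_affX.
rewrite /ps_comp_aff (@ssum_fin _ (size p)) => [|n pn]; last first.
  by rewrite /psp nth_default ?mul0r // (leq_trans pn) // leq_addr.
(* Both sides are sums of [F]: the range is extended to [size p + k] by zero terms, its first [k]
   terms vanish, and the rest is shifted by [k]. *)
pose F i := if (k <= i)%N then psp p i * ('C(i, k)%:R * al ^+ k * be ^+ (i - k)) else 0.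
transitivity (\sum_(0 <= i < size p) F i); last first.
  by rewrite big_mkord; apply: eq_bigr => i _; rewrite /F; case: ifP; rewrite ?mulr0.
have -> : \sum_(0 <= i < size p) F i = \sum_(0 <= i < size p + k) F i.
  rewrite [RHS](@big_cat_nat _ _ _ (size p)) ?leq_addr //=.
  rewrite (_ : \sum_(size p <= i < _) F i = 0) ?addr0 // big_nat big1 //.
  move=> i /andP[pi _]; rewrite /F /psp nth_default // mul0r; by case: ifP.
rewrite [RHS](@big_cat_nat _ _ _ k) ?leq_addl //=.
rewrite (_ : \sum_(0 <= i < k) F i = 0) ?add0r; last first.
  rewrite big_nat big1 // => i /andP[_ ik]; by rewrite /F leqNgt ik.
have -> : \sum_(k <= i < size p + k) F i = \sum_(0 <= i < size p) F (i + k)%N.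
  by rewrite -{1}[k]add0n big_addn addnK.
rewrite big_mkord; apply: eq_bigr => i _.
by rewrite /F leq_addl addnK !mulrA.
Qed.

End Affine.

(* Polynomials are dense among entire functions for every Gauss norm. *)
Lemma entire_density (A : ps K -> K) r M : 0 < r ->
  (forall g h, entire abs g -> entire abs h -> A (ps_add g h) = A g + A h) ->
  (forall g, entire abs g -> abs (A g) <= M * mu_ps abs r g) ->
  (forall p, A (psp p) = 0) -> forall g, entire abs g -> A g = 0.
Proof.
move=> r0 Aadd Abd Ap g Eg; apply/eqP/negPn/negP; rewrite -(abs_gt0 Habs) => Ag0.
pose M' := Num.max M 1.
have M0 : 0 < M' by rewrite /M' lt_max ltr01 orbT.
(* Since [A] kills the truncation, [A g] equals [A] of the tail; this threshold forces |A g| <= |A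
   g| / 2. *)
have e0 : 0 < abs (A g) / M' / 2 by rewrite !divr_gt0.
have [N HN] := Eg r r0 _ e0.
pose t := ps_add g (ps_opp (psp (trunc N g))).
have Et : entire abs t.
  by apply: ps_add_entire => //; apply: ps_opp_entire => //; apply: psp_entire.
have Eg' : g = ps_add (psp (trunc N g)) t.
  by apply/funext => n; rewrite /t /ps_add /ps_opp; ring.
have mut : mu_ps abs r t <= abs (A g) / M' / 2.
  apply: mu_ps_le => n; rewrite /t /ps_add /ps_opp /psp coef_poly.
  case: ltnP => nN; first by rewrite subrr (abs0 Habs) mul0r ltW.
  by rewrite subr0 ltW // HN.
have Et0 : abs (A g) <= M' * mu_ps abs r t.
  rewrite {1}Eg' Aadd ?Ap ?add0r //; last exact: psp_entire.
  apply: le_trans (Abd t Et) _; apply: ler_wpM2r; first exact: mu_ps_ge0.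
  by rewrite /M' le_max lexx.
have : M' * mu_ps abs r t <= abs (A g) / 2.
  rewrite -ler_pdivlMl //; apply: le_trans mut _.
  by rewrite le_eqVlt; apply/orP; left; apply/eqP; field; rewrite gt_eqF.
move=> /(le_trans Et0); lra.
Qed.

(** The multiplicativity defect [B] is biadditive, bounded in each argument for the Gauss norm, and
    zero on pairs of polynomials. Density, applied to one argument at a time, makes it vanish. *)
Lemma comp_mul al be g h : abs al = 1 -> entire abs g -> entire abs h ->
  ps_comp_aff abs al be (ps_mul g h) =
  ps_mul (ps_comp_aff abs al be g) (ps_comp_aff abs al be h).
Proof.
move=> Hal Eg Eh; apply/funext => k; apply/eqP; rewrite -subr_eq0; apply/eqP.
pose B g h := ps_comp_aff abs al be (ps_mul g h) k -
  ps_mul (ps_comp_aff abs al be g) (ps_comp_aff abs al be h) k.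
pose r := Num.max 1 (abs be).
have r0 : 0 < r by rewrite /r lt_max ltr01.
have ber : abs be <= r by rewrite /r le_max lexx orbT.
have rk : 0 < r ^+ k by rewrite exprn_gt0.
have EM := ps_mul_entire Habs; have EC := comp_entire be Hal.
have Badd f1 f2 f3 : entire abs f1 -> entire abs f2 -> entire abs f3 ->
    B (ps_add f1 f2) f3 = B f1 f3 + B f2 f3.
  move=> E1 E2 E3; rewrite /B ps_mulDl !comp_add //; try exact: EM.
  by rewrite ps_mulDl /ps_add; ring.
have Bbd f1 f2 : entire abs f1 -> entire abs f2 ->
    abs (B f1 f2) <= (mu_ps abs r f2 / r ^+ k) * mu_ps abs r f1.
  move=> E1 E2; have E12 := EM _ _ E1 E2.
  have -> : (mu_ps abs r f2 / r ^+ k) * mu_ps abs r f1 =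
      mu_ps abs r f1 * mu_ps abs r f2 / r ^+ k by ring.
  apply: (absD_le Habs); rewrite ?(absN Habs).
    apply: le_trans (abs_coef_le Habs _ (EC _ E12) r0) _.
    by rewrite ler_pM2r ?invr_gt0 // -(mu_psM Habs) //; apply: comp_mu_le.
  apply: le_trans (abs_coef_le Habs _ (EM _ _ (EC _ E1) (EC _ E2)) r0) _.
  rewrite ler_pM2r ?invr_gt0 // (mu_psM Habs) //; try exact: EC.
  by rewrite ler_pM ?mu_ps_ge0 ?comp_mu_le //; apply: EC.
have BC f1 f2 : B f1 f2 = B f2 f1.
  by rewrite /B ps_mulC; congr (_ - _); rewrite ps_mulC.
have Bpp p q : B (psp p) (psp q) = 0.
  by rewrite /B -psp_mul !comp_psp // -psp_mul comp_polyM subrr.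
have Bp p f : entire abs f -> B f (psp p) = 0.
  move=> Ef; have Ep := psp_entire Habs p.
  apply: (@entire_density (fun f => B f (psp p)) r _ r0 _ _ (fun q => Bpp q p)) => //.
  - by move=> f1 f2 E1 E2; apply: Badd.
  - by move=> f1 E1; apply: Bbd.
apply: (@entire_density (fun f => B f h) r _ r0) => //.
- by move=> f1 f2 E1 E2; apply: Badd.
- by move=> f1 E1; apply: Bbd.
- by move=> p; rewrite BC; apply: Bp.
Qed.

Lemma comp_comp al1 be1 al2 be2 g : abs al1 = 1 -> abs al2 = 1 -> entire abs g ->
  ps_comp_aff abs al1 be1 (ps_comp_aff abs al2 be2 g) =
  ps_comp_aff abs (al2 * al1) (al2 * be1 + be2) g.
Proof.
move=> H1 H2; have H12 : abs (al2 * al1) = 1 by rewrite (absM Habs) H1 H2 mulr1.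
move=> Eg; apply/funext => k; apply/eqP; rewrite -subr_eq0; apply/eqP.
move: g Eg; pose r := Num.max 1 (Num.max (abs be1) (abs be2)).
have r0 : 0 < r by rewrite /r lt_max ltr01.
have b1 : abs be1 <= r by rewrite /r !le_max lexx orbT.
have b2 : abs be2 <= r by rewrite /r !le_max lexx !orbT.
have b12 : abs (al2 * be1 + be2) <= r.
  by apply: (absD_le Habs) => //; rewrite (absM Habs) H2 mul1r.
have E1 := comp_entire be1 H1; have E2 := comp_entire be2 H2.
have E12 := comp_entire (al2 * be1 + be2) H12.
have rk : 0 < r ^+ k by rewrite exprn_gt0.
apply: (@entire_density _ r (r ^+ k)^-1 r0).
- by move=> g h Eg Eh; rewrite !comp_add //; [rewrite /ps_add; ring | apply: E2 | apply: E2].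
- move=> g Eg; rewrite [leRHS]mulrC; apply: (absD_le Habs); rewrite ?(absN Habs).
    apply: le_trans (abs_coef_le Habs _ (E1 _ (E2 _ Eg)) r0) _.
    rewrite ler_pM2r ?invr_gt0 //.
    by apply: le_trans (comp_mu_le _ _ r0 _) (comp_mu_le _ _ r0 _) => //; apply: E2.
  apply: le_trans (abs_coef_le Habs _ (E12 _ Eg) r0) _.
  by rewrite ler_pM2r ?invr_gt0 // comp_mu_le.
move=> p; rewrite !comp_psp // -comp_polyA comp_polyD comp_polyM !comp_polyC comp_polyX.
apply/eqP; rewrite subr_eq0; apply/eqP; congr (psp (p \Po _) k).
by rewrite !rmorphD !rmorphM /=; ring.
Qed.

Lemma comp_id g : entire abs g -> ps_comp_aff abs 1 0 g = g.
Proof.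
move=> Eg; apply/funext => k; apply/eqP; rewrite -subr_eq0; apply/eqP; move: g Eg.
have H1 := abs1 Habs; have E1 := comp_entire 0 H1.
apply: (@entire_density _ 1 1 ltr01).
- by move=> g h Eg Eh; rewrite comp_add // /ps_add; ring.
- move=> g Eg; rewrite mul1r; apply: (absD_le Habs); rewrite ?(absN Habs).
    apply: le_trans (abs_coef_le Habs _ (E1 _ Eg) ltr01) _.
    by rewrite expr1n divr1 comp_mu_le // (abs0 Habs) ler01.
  by apply: le_trans (abs_coef_le Habs _ Eg ltr01) _; rewrite expr1n divr1.
by move=> p; rewrite comp_psp // mul1r addr0 comp_polyXr subrr.
Qed.

Lemma compK al be g : abs al = 1 -> entire abs g ->
  ps_comp_aff abs al^-1 (- (be / al)) (ps_comp_aff abs al be g) = g.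
Proof.
move=> Hal Eg; have [al0 HV] := absV1 Habs Hal.
rewrite comp_comp // mulfV // (_ : _ + be = 0) ?comp_id //.
by field.
Qed.

(** The inverse map has translation part - be / al, of the same absolute value as [be], so the
    inequality applies in both directions. *)
Lemma comp_mu al be g r : abs al = 1 -> entire abs g -> 0 < r -> abs be <= r ->
  mu_ps abs r (ps_comp_aff abs al be g) = mu_ps abs r g.
Proof.
move=> Hal Eg r0 ber; apply/eqP; rewrite eq_le comp_mu_le //=.
have [al0 HV] := absV1 Habs Hal.
rewrite -{1}(compK be Hal Eg); apply: comp_mu_le => //; first exact: comp_entire.
by rewrite (absN Habs) (absM Habs) HV mulr1.
Qed.

Lemma comp_opp al be g : abs al = 1 -> entire abs g ->
  ps_comp_aff abs al be (ps_opp g) = ps_opp (ps_comp_aff abs al be g).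
Proof.
move=> Hal Eg; have EN := ps_opp_entire Habs Eg.
have : ps_comp_aff abs al be (ps_add g (ps_opp g)) = ps0 K.
  have -> : ps_add g (ps_opp g) = psp 0.
    by apply/funext => n; rewrite /ps_add /ps_opp subrr /psp coef0.
  by rewrite comp_psp // comp_poly0 psp0.
rewrite comp_add // => H; apply/funext => k; have := congr1 (fun x => x k) H.
by rewrite /ps_add /ps_opp /ps0 => /eqP; rewrite addrC addr_eq0 => /eqP.
Qed.

Lemma comp_neq0 al be g : abs al = 1 -> entire abs g -> g <> ps0 K ->
  ps_comp_aff abs al be g <> ps0 K.
Proof.
move=> Hal Eg g0 H; apply: g0; rewrite -(compK be Hal Eg) H -psp0.
have [al0 HV] := absV1 Habs Hal.
by rewrite comp_psp // comp_poly0.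
Qed.

End Substitution.

(** * Zeros and Jensen's formula *)

Section LowIndex.
Variables (K : fieldType) (R : realType) (abs : K -> R).
Hypotheses (Habs : nonarch_abs abs) (Hcomplete : completeK abs).
Implicit Types (g h : ps K) (z w : K) (r : R).

(** Order of vanishing at the origin; [is_ord abs g z] unfolds to this notion for the translate of
    [g] by [z]. *)
Definition low_index g k := (forall i, (i < k)%N -> g i = 0) /\ g k != 0.

Lemma low_index_unique g k l : low_index g k -> low_index g l -> k = l.
Proof.
move=> [gk gk0] [gl gl0]; case: (ltngtP k l) => // kl.
  by move: gk0; rewrite gl // eqxx.
by move: gl0; rewrite gk // eqxx.
Qed.

Lemma low_index_exists g n : g n != 0 -> exists k, low_index g k.
Proof.
move=> gn; have ex : exists n, g n != 0 by exists n.
case: (ex_minnP ex) => k gk mink; exists k; split => // i ik.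
by apply/eqP/negPn/negP => /mink; rewrite leqNgt ik.
Qed.

Lemma low_index_mulE g h k l : low_index g k -> low_index h l ->
  ps_mul g h (k + l)%N = g k * h l.
Proof.
move=> [gk _] [hl _]; have kkl : (k < (k + l).+1)%N by rewrite ltnS leq_addr.
rewrite /ps_mul (bigD1 (Ordinal kkl)) //= addKn big1 ?addr0 // => i ik.
have ik' : (i : nat) != k by apply: contraNneq ik => ik; apply/eqP/val_inj.
have [ltik|leki] := ltnP i k; first by rewrite gk // mul0r.
have ki : (k < i)%N by rewrite ltn_neqAle eq_sym ik' leki.
rewrite hl ?mulr0 //; move: ki (ltn_ord i); lia.
Qed.

Lemma low_index_mul g h k l : low_index g k -> low_index h l ->
  low_index (ps_mul g h) (k + l).
Proof.
move=> Hg Hh; split; last first.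
  by rewrite (low_index_mulE Hg Hh) mulf_neq0 //; [case: Hg | case: Hh].
case: Hg Hh => [gk _] [hl _] i ikl; rewrite /ps_mul big1 // => j _.
have [ltjk|lekj] := ltnP j k; first by rewrite gk // mul0r.
by rewrite hl ?mulr0 //; have := ltn_ord j; lia.
Qed.

Lemma is_ord_unique g z k l : is_ord abs g z k -> is_ord abs g z l -> k = l.
Proof. exact: low_index_unique. Qed.

Lemma ord_eq g z k : is_ord abs g z k -> ord abs g z = k.
Proof.
move=> Hk; apply: (is_ord_unique _ Hk).
exact: (ClassicalEpsilon.epsilon_spec (inhabits 0%N) (is_ord abs g z) (ex_intro _ k Hk)).
Qed.

Lemma is_ord_exists g z : entire abs g -> g <> ps0 K -> exists k, is_ord abs g z k.
Proof.
move=> Eg g0; have := comp_neq0 Habs Hcomplete (be := z) (abs1 Habs) Eg g0.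
by move=> /ps_neq0[n]; apply: low_index_exists.
Qed.

Lemma ordP g z : entire abs g -> g <> ps0 K -> is_ord abs g z (ord abs g z).
Proof. by move=> Eg g0; have [k Hk] := is_ord_exists z Eg g0; rewrite (ord_eq Hk). Qed.

Lemma is_ord_mul g h z k l : entire abs g -> entire abs h ->
  is_ord abs g z k -> is_ord abs h z l -> is_ord abs (ps_mul g h) z (k + l).
Proof.
move=> Eg Eh Hg Hh; rewrite /is_ord (comp_mul Habs Hcomplete _ (abs1 Habs)) //.
exact: low_index_mul.
Qed.

Lemma comp_psp_translate (p : {poly K}) z :
  ps_comp_aff abs 1 z (psp p) = psp (p \Po ('X + z%:P)).
Proof. by rewrite (comp_psp Habs) ?mul1r //; exact: abs1. Qed.

Lemma comp_psp_horner (p : {poly K}) z : ps_comp_aff abs 1 z (psp p) 0%N = p.[z].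
Proof.
by rewrite comp_psp_translate /psp -horner_coef0 horner_comp !hornerE.
Qed.

(** The boolean is read as the order, 0 or 1; [XsubC_top_index] uses the same coercion. *)
Lemma is_ord_XsubC z w : is_ord abs (psp ('X - w%:P)) z (z == w).
Proof.
rewrite /is_ord comp_psp_translate comp_polyB comp_polyX comp_polyC -addrA -polyCB.
rewrite /psp; case: eqP => [->|/eqP zw].
  rewrite subrr addr0; split; last by rewrite coefX oner_eq0.
  by case=> // _; rewrite coefX.
by split=> //; rewrite coefD coefX coefC add0r subr_eq0.
Qed.

Lemma XsubC_mu z r : 0 < r -> abs z <= r -> mu_ps abs r (psp ('X - z%:P)) = r.
Proof.
move=> r0 zr; have E := psp_entire Habs ('X - z%:P); apply/eqP.
rewrite eq_le; apply/andP; split; last first.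
  apply: le_trans (mu_ps_ub Habs 1 E r0).
  by rewrite /psp coefB coefX coefC subr0 (abs1 Habs) mul1r expr1.
apply: mu_ps_le => -[|[|n]]; rewrite /psp coefB coefX coefC.
- by rewrite sub0r (absN Habs) expr0 mulr1.
- by rewrite subr0 (abs1 Habs) mul1r expr1.
- by rewrite subr0 (abs0 Habs) mul0r ltW.
Qed.

Lemma XsubC_mu_out z r : 0 < r -> r < abs z -> mu_ps abs r (psp ('X - z%:P)) = abs z.
Proof.
move=> r0 rz; have E := psp_entire Habs ('X - z%:P); apply/eqP.
rewrite eq_le; apply/andP; split; last first.
  apply: le_trans (mu_ps_ub Habs 0 E r0).
  by rewrite /psp coefB coefX coefC sub0r (absN Habs) expr0 mulr1.
apply: mu_ps_le => -[|[|n]]; rewrite /psp coefB coefX coefC.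
- by rewrite sub0r (absN Habs) expr0 mulr1.
- by rewrite subr0 (abs1 Habs) mul1r expr1 ltW.
- by rewrite subr0 (abs0 Habs) mul0r (abs_ge0 Habs).
Qed.

Lemma XsubC_top_index z r : 0 < r -> top_index abs r (psp ('X - z%:P)) (abs z <= r)%R.
Proof.
move=> r0; rewrite /top_index; have [zr|rz] := leP (abs z) r.
  rewrite XsubC_mu //; split.
    by rewrite /psp coefB coefX coefC subr0 (abs1 Habs) mul1r expr1.
  by case=> [|[|n]] // _; rewrite /psp coefB coefX coefC subr0 (abs0 Habs) mul0r.
rewrite XsubC_mu_out //; split.
  by rewrite /psp coefB coefX coefC sub0r (absN Habs) expr0 mulr1.
case=> [|[|n]] // _; rewrite /psp coefB coefX coefC subr0.
  by rewrite (abs1 Habs) mul1r expr1.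
by rewrite (abs0 Habs) mul0r (lt_trans r0).
Qed.

Lemma top_index_unique g r k l : top_index abs r g k -> top_index abs r g l -> k = l.
Proof.
move=> [gk kn] [gl ln]; case: (ltngtP k l) => // kl.
  by have := kn _ kl; rewrite gl ltxx.
by have := ln _ kl; rewrite gk ltxx.
Qed.

Lemma pspC_top_index (c : K) r : c != 0 -> 0 < r ->
  top_index abs r (psp c%:P) 0 /\ mu_ps abs r (psp c%:P) = abs c.
Proof.
move=> c0 r0; have Emu : mu_ps abs r (psp c%:P) = abs c.
  apply/eqP; rewrite eq_le; apply/andP; split.
    apply: mu_ps_le => -[|n]; rewrite /psp coefC ?expr0 ?mulr1 //=.
    by rewrite (abs0 Habs) mul0r (abs_ge0 Habs).
  apply: le_trans (mu_ps_ub Habs 0 (psp_entire Habs _) r0).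
  by rewrite /psp coefC expr0 mulr1.
rewrite /top_index Emu; split=> //; split; first by rewrite /psp coefC expr0 mulr1.
case=> // n _; rewrite /psp coefC /= (abs0 Habs) mul0r (abs_gt0 Habs) //.
Qed.

Lemma prod_XsubC_top_index r (s : seq K) : 0 < r ->
  mu_ps abs r (psp (\prod_(w <- s) ('X - w%:P))) =
    \prod_(w <- s) Num.max r (abs w) /\
  top_index abs r (psp (\prod_(w <- s) ('X - w%:P))) (count (fun w => abs w <= r) s).
Proof.
move=> r0; elim: s => [|w s [IHm IHt]].
  rewrite !big_nil -polyC1; have [] := pspC_top_index (oner_neq0 K) r0.
  by rewrite (abs1 Habs).
rewrite !big_cons psp_mul.
have [] := top_index_mul Habs (psp_entire Habs _) (psp_entire Habs _) r0
  (XsubC_top_index w r0) IHt.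
move=> -> Ht; split => //; rewrite IHm; congr (_ * _).
by have [wr|wr] := leP (abs w) r; [rewrite XsubC_mu | rewrite XsubC_mu_out].
Qed.

End LowIndex.

Lemma seq_argmin (T : eqType) (R : realDomainType) (F : T -> R) (x : T) (s : seq T) :
  exists2 y, y \in x :: s & forall w, w \in x :: s -> F y <= F w.
Proof.
elim: s x => [|z s IH] x; first by exists x => [|w]; rewrite ?mem_head // inE => /eqP ->.
have [y ys ymin] := IH z; have [xy|yx] := leP (F x) (F y).
  exists x; first exact: mem_head.
  by move=> w; rewrite inE => /predU1P[->//|/ymin]; apply: le_trans.
exists y; first by rewrite inE ys orbT.
by move=> w; rewrite inE => /predU1P[->|/ymin//]; apply: ltW.
Qed.

(** * Existence of zeros, factorization in a disc, Jensen's formula *)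

Section Zeros.
Variables (K : closedFieldType) (R : realType) (abs : K -> R).
Hypotheses (Habs : nonarch_abs abs) (Hcomplete : completeK abs).
Implicit Types (g h : ps K) (z w : K) (r : R).

Let abs_ge0' := abs_ge0 Habs.
Hint Resolve abs_ge0' : core.

(** Exactly [k] roots lie in the disc; take [w] to be the one nearest to [z]. Each of them
    contributes at least |z - w| to |p(z)| and [r] to the norm, while a root [y] outside contributes
    |y| to both. *)
Lemma root_near (p : {poly K}) r k z : 0 < r -> top_index abs r (psp p) k ->
  (0 < k)%N -> abs z <= r ->
  exists w, [/\ root p w, abs w <= r &
    abs (z - w) ^+ k * mu_ps abs r (psp p) <= abs p.[z] * r ^+ k].
Proof.
move=> r0 tp k0 zr; have Ep := psp_entire Habs p.
have p0 : p != 0.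
  apply/eqP => p0; move: (top_index_neq0 Habs Ep r0 tp).
  by rewrite p0 psp0 (mu_ps0 Habs) ltxx.
have c0 : lead_coef p != 0 by rewrite lead_coef_eq0.
have [rs Ers] := closed_field_poly_normal p.
have [mP tP] := prod_XsubC_top_index Habs rs r0.
have [tc mc] := pspC_top_index Habs c0 r0.
have [] := top_index_mul Habs (psp_entire Habs _) (psp_entire Habs _) r0 tc tP.
rewrite -psp_mul mul_polyC -Ers mc mP => mp.
rewrite add0n => /(top_index_unique tp) Ek.
have : [seq w <- rs | abs w <= r] != [::].
  by rewrite -size_eq0 size_filter -Ek -lt0n.
case Es : [seq w <- rs | abs w <= r] => [//|x s] _.
have [w ws wmin] := seq_argmin (fun w => abs (z - w)) x s.
have : w \in [seq w <- rs | abs w <= r] by rewrite Es.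
rewrite mem_filter => /andP[wr wrs].
exists w; split => //.
  by rewrite Ers rootZ // root_prod_XsubC.
rewrite mp [p in p.[z]]Ers hornerZ (absM Habs) horner_prod (abs_prod Habs).
rewrite mulrCA -[leRHS]mulrA ler_pM2l ?(abs_gt0 Habs) // Ek.
have {}wmin y : y \in rs -> abs y <= r -> abs (z - w) <= abs (z - y).
  by move=> yrs yr; apply: wmin; rewrite -Es mem_filter yr.
(* With the leading coefficient cancelled, the two products are compared root by root. *)
elim: rs wmin {Ers mP tP mp Ek Es wrs} => [|y rs IH] wmin.
  by rewrite !big_nil !expr0.
have {}IH := IH (fun y yrs => wmin y (mem_behead (s := _ :: _) yrs)).
rewrite !big_cons /= hornerXsubC; have [yr|ry] := leP (abs y) r.
  rewrite add1n !exprS.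
  rewrite [leLHS](_ : _ = (abs (z - w) * r) * (abs (z - w) ^+ count (fun w => abs w <= r) rs *
    \prod_(j <- rs) Num.max r (abs j))); last by ring.
  rewrite [leRHS](_ : _ = (abs (z - y) * r) * ((\prod_(j <- rs) abs ('X - j%:P).[z]) *
    r ^+ count (fun w => abs w <= r) rs)); last by ring.
  apply: ler_pM => //.
  - by rewrite mulr_ge0 // ltW.
  - rewrite mulr_ge0 ?exprn_ge0 ?prodr_ge0 // => j _.
    by rewrite le_max (ltW r0).
  - by rewrite ler_pM2r // wmin ?mem_head.
rewrite add0n mulrCA -[leRHS]mulrA.
have -> : abs (z - y) = abs y.
  rewrite (absB Habs); apply: (absD_dom Habs); rewrite (absN Habs).
  exact: le_lt_trans zr ry.
by apply: ler_wpM2l.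
Qed.

(** Write p = q (X - w): |q(z)| is at most the norm of [q], which is that of [p] divided by [r]. The
    resulting Lipschitz constant depends on [p] only through its norm, so it is uniform over
    truncations. *)
Lemma horner_root_le (p : {poly K}) r z w : 0 < r -> abs z <= r -> abs w <= r ->
  root p w -> abs p.[z] * r <= abs (z - w) * mu_ps abs r (psp p).
Proof.
move=> r0 zr wr /factor_theorem[q ->]; rewrite hornerM hornerXsubC.
rewrite psp_mul (mu_psM Habs) ?(XsubC_mu Habs) //; try exact: psp_entire.
rewrite (absM Habs) -mulrA mulrCA; apply: ler_wpM2l => //; rewrite ler_pM2r //.
rewrite -(comp_psp_horner Habs).
have := comp_coef_le Habs Hcomplete (k := 0) (abs1 Habs) (psp_entire Habs q) r0 zr
  (fun n _ => mu_ps_ub Habs n (psp_entire Habs q) r0).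
by rewrite expr0 mulr1.
Qed.

Lemma cvgK_step (u : nat -> K) : null abs (fun n => u n.+1 - u n) ->
  exists l, cvgK abs u l.
Proof.
move=> /(ssum_cvg Habs Hcomplete); set s := ssum _ _ => Hs; exists (u 0%N + s).
move=> e /Hs [N HN]; exists N => n /HN.
rewrite -(big_mkord xpredT (fun i => u i.+1 - u i)) telescope_sumr //.
by rewrite opprD addrA.
Qed.

Lemma trunc_top_index g r k N : entire abs g -> 0 < r -> top_index abs r g k ->
  (k < N)%N -> top_index abs r (psp (trunc N g)) k /\
  mu_ps abs r (psp (trunc N g)) = mu_ps abs r g.
Proof.
move=> Eg r0 [gk gn] kN; have Et := psp_entire Habs (trunc N g).
have m0 := top_index_neq0 Habs Eg r0 (conj gk gn).
have Emu : mu_ps abs r (psp (trunc N g)) = mu_ps abs r g.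
  apply/eqP; rewrite eq_le; apply/andP; split.
    apply: mu_ps_le => n; rewrite /psp coef_poly; case: ifP => _; last first.
      by rewrite (abs0 Habs) mul0r ltW.
    exact: mu_ps_ub.
  by rewrite -gk; apply: le_trans (mu_ps_ub Habs k Et r0); rewrite /psp coef_poly kN.
split=> //; rewrite /top_index Emu /psp; split=> [|n kn]; rewrite coef_poly ?kN //.
by case: ifP => _; [apply: gn | rewrite (abs0 Habs) mul0r].
Qed.

(* Each root of a truncation lies close to a root of the next one, so some
   sequence of roots converges, and its limit is a zero of [g]. *)
Lemma zero_exists g r k : entire abs g -> 0 < r -> top_index abs r g k ->
  (0 < k)%N -> exists2 z, abs z <= r & ps_comp_aff abs 1 z g 0%N = 0.
Proof.
move=> Eg r0 tg k0; have m0 := top_index_neq0 Habs Eg r0 tg.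
set m := mu_ps abs r g in m0.
(* Starting beyond degree [k] keeps the top index [k] and the norm of [g] for every truncation. *)
pose q n := trunc (k + n).+1 g.
have tq n : top_index abs r (psp (q n)) k /\ mu_ps abs r (psp (q n)) = m.
  by apply: trunc_top_index => //; rewrite ltnS leq_addr.
pose good n z := root (q n) z /\ abs z <= r.
pose e_ n := abs (g (k + n)%N) * r ^+ (k + n).
(* At a root of [q n] the value of [q n.+1] is just the newly added monomial, of size at most
   [e_ n.+1], so [root_near] yields a close root. Outside [good] an arbitrary value is returned, so
   that [choice] applies to all pairs. *)
have step (x : nat * K) : exists w, good x.1 x.2 ->
    good x.1.+1 w /\ abs (w - x.2) ^+ k * m <= e_ x.1.+1 * r ^+ k.
  case: x => n z /=; have [[rz zr]|] := pselect (good n z); last by exists 0.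
  have [t mt] := tq n.+1.
  have [w [rw wr]] := root_near r0 t k0 zr; rewrite mt => Hw.
  exists w => _; split; first by split.
  rewrite (absB Habs); apply: le_trans Hw _; rewrite ler_pM2r ?exprn_gt0 //.
  have -> : q n.+1 = q n + (g (k + n).+1)%:P * 'X^((k + n).+1).
    apply/polyP => i; rewrite coefD coefCM coefXn !coef_poly addnS ltnS leq_eqVlt.
    case: eqP => [->|/eqP ni] /=; first by rewrite ltnn add0r mulr1.
    by rewrite mulr0 addr0.
  rewrite hornerD (rootP rz) add0r hornerM hornerC hornerXn (absM Habs) (absX Habs).
  rewrite /e_ addnS; apply: ler_wpM2l => //.
  by rewrite lerXn2r ?nnegrE // ltW.
have [F HF] := choice step.
have [z0 [rz0 z0r _]] : exists w, [/\ root (q 0%N) w, abs w <= r &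
    abs (0 - w) ^+ k * mu_ps abs r (psp (q 0%N)) <= abs (q 0%N).[0] * r ^+ k].
  by apply: (root_near r0 (tq 0%N).1 k0); rewrite (abs0 Habs) ltW.
pose z := fix z n := if n is n'.+1 then F (n', z n') else z0.
have zgood n : good n (z n).
  by elim: n => [//|n IH]; have [] := HF (n, z n) IH.
have zstep n : abs (z n.+1 - z n) ^+ k * m <= e_ n.+1 * r ^+ k.
  by have [] := HF (n, z n) (zgood n).
have [l Hl] : exists l, cvgK abs z l.
  apply: cvgK_step => e e0.
  (* A step of length at least [e] would force [e_ n.+1] to be at least this quantity. *)
  have d0 : 0 < e ^+ k * m / r ^+ k by rewrite !(mulr_gt0, invr_gt0, exprn_gt0).
  have [N HN] := Eg r r0 _ d0; exists N => n Nn.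
  rewrite ltNge; apply/negP => le_e.
  have : e_ n.+1 < e ^+ k * m / r ^+ k by apply: HN; lia.
  rewrite ltr_pdivlMr ?exprn_gt0 // ltNge => /negP; apply.
  apply: le_trans (zstep n); rewrite ler_pM2r // lerXn2r ?nnegrE //.
  exact: ltW.
have lr : abs l <= r.
  have [N HN] := Hl r r0; rewrite -(subrK (z N) l); apply: (absD_le Habs).
    by rewrite (absB Habs) ltW // HN.
  by case: (zgood N).
exists l => //; apply/eqP/negPn/negP; rewrite -(abs_gt0 Habs).
set v := ps_comp_aff _ _ _ _ _ => v0.
have v20 : 0 < abs v / 2 by rewrite divr_gt0.
have [N1 HN1] := Eg r r0 _ v20.
(* If the root [z n] of [q n] is this close to [l], [horner_root_le] gives |q_n(l)| <= |v| / 2. The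
   tail of [g] is also at most |v| / 2, so |v| <= |v| / 2, which is absurd. *)
have d0 : 0 < abs v / 2 * r / m by rewrite !(divr_gt0, mulr_gt0).
have [N2 HN2] := Hl _ d0.
pose n := maxn N1 N2.
pose t := ps_add g (ps_opp (psp (q n))).
have Eq := psp_entire Habs (q n); have EN := ps_opp_entire Habs Eq.
have Et : entire abs t by apply: ps_add_entire.
have Ev : v = ps_comp_aff abs 1 l t 0%N + (q n).[l].
  rewrite /t (comp_add Habs Hcomplete l (abs1 Habs)) //.
  rewrite (comp_opp Habs Hcomplete l (abs1 Habs)) // /ps_add /ps_opp.
  by rewrite comp_psp_horner // subrK.
have : abs v <= abs v / 2; last by lra.
rewrite {1}Ev; apply: (absD_le Habs).
  have H0 i : (0 <= i)%N -> abs (t i) * r ^+ i <= abs v / 2.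
    move=> _; rewrite /t /ps_add /ps_opp /psp coef_poly; case: ltnP => ni.
      by rewrite subrr (abs0 Habs) mul0r ltW.
    rewrite subr0 ltW // HN1 //; apply: leq_trans (leq_trans _ ni).
      exact: (leq_maxl N1 N2).
    by rewrite -/n ltnW // ltnS leq_addl.
  have := comp_coef_le Habs Hcomplete (k := 0) (abs1 Habs) Et r0 lr H0.
  by rewrite expr0 mulr1.
have [rn nr] := zgood n.
have := horner_root_le r0 lr nr rn; rewrite (tq n).2 => H.
rewrite -(ler_pM2r r0); apply: le_trans H _; rewrite -ler_pdivlMr //.
by rewrite (absB Habs) ltW // HN2 // leq_maxr.
Qed.

(** The zero is translated to the origin, where division by ['X] is a shift of coefficients, and the
    quotient is translated back. *)
Lemma divide_zero g z : entire abs g -> ps_comp_aff abs 1 z g 0%N = 0 ->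
  exists2 u, entire abs u & g = ps_mul (psp ('X - z%:P)) u.
Proof.
move=> Eg gz; pose h := ps_comp_aff abs 1 z g.
have Eh : entire abs h by apply: comp_entire => //; exact: abs1.
pose s : ps K := fun n => h n.+1.
have Es : entire abs s.
  move=> r r0 e e0; have [N HN] := Eh r r0 (e * r) (mulr_gt0 e0 r0); exists N => n Nn.
  by rewrite -(ltr_pM2r r0) -mulrA -exprSr HN // (leq_trans Nn).
have hs : h = ps_mul (psp 'X) s.
  apply/funext => -[|n]; rewrite /ps_mul big_ord_recl /psp coefX mul0r add0r.
    by rewrite big_ord0.
  rewrite big_ord_recl coefX /= mul1r big1 ?addr0 ?subSS ?subn0 // => i _.
  by rewrite coefX /= mul0r.
exists (ps_comp_aff abs 1 (- z) s); first by apply: comp_entire => //; exact: abs1.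
rewrite -[LHS](compK Habs Hcomplete z (abs1 Habs) Eg) -/h hs invr1 mulr1.
rewrite (comp_mul Habs Hcomplete (- z) (abs1 Habs)) //; last exact: psp_entire.
by rewrite comp_psp_translate // comp_polyX polyCN.
Qed.

(** Splitting off a zero in the disc lowers the top index by exactly one, whence the induction on
    [k]. *)
Lemma disc_factor g r k : entire abs g -> 0 < r -> top_index abs r g k ->
  exists s u, [/\ all (fun w => abs w <= r) s, entire abs u, top_index abs r u 0 &
    g = ps_mul (psp (\prod_(w <- s) ('X - w%:P))) u].
Proof.
move=> + r0; elim: k g => [|k IH] g Eg tg.
  by exists [::], g; split; rewrite ?big_nil ?psp1 ?ps_mul1.
have [z zr gz] := zero_exists Eg r0 tg isT.
have [v Ev Egv] := divide_zero Eg gz.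
have [n vn] : exists n, v n != 0.
  apply: ps_neq0 => v0; have := top_index_neq0 Habs Eg r0 tg.
  by rewrite Egv v0 (mu_psM Habs) ?(mu_ps0 Habs) ?mulr0 ?ltxx //;
    [exact: psp_entire | exact: ps0_entire].
have [l tv] := top_index_exists Habs Ev r0 vn.
have [_] := top_index_mul Habs (psp_entire Habs _) Ev r0 (XsubC_top_index Habs z r0) tv.
rewrite -Egv zr => /(top_index_unique tg)[kl].
rewrite add0n in kl; rewrite -kl in tv; have [s [u [sr Eu tu Evu]]] := IH v Ev tv.
exists (z :: s), u; split => //=; first by rewrite zr.
by rewrite big_cons psp_mul -ps_mulA -Evu.
Qed.

(** The constant term strictly dominates the rest on the whole disc, so [u] has no zero there. *)
Lemma is_ord_top0 u r z : entire abs u -> 0 < r -> top_index abs r u 0 -> abs z <= r ->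
  is_ord abs u z 0.
Proof.
move=> Eu r0 [u0 un] zr; rewrite expr0 mulr1 in u0.
have m0 := top_index_neq0 Habs Eu r0 (conj (etrans (mulr1 _) u0 : abs (u 0%N) * r ^+ 0 = _) un).
split=> //; rewrite -(abs_gt0 Habs).
pose t := ps_add u (ps_opp (psp (u 0%N)%:P)).
have EC := psp_entire Habs (u 0%N)%:P; have EN := ps_opp_entire Habs EC.
have Et : entire abs t by apply: ps_add_entire.
have mt : mu_ps abs r t < mu_ps abs r u.
  apply: (mu_ps_lt Habs) => // -[|n]; rewrite /t /ps_add /ps_opp /psp coefC /=.
    by rewrite subrr (abs0 Habs) mul0r.
  by rewrite subr0 un.
have Eut : ps_comp_aff abs 1 z u 0%N = u 0%N + ps_comp_aff abs 1 z t 0%N.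
  rewrite /t (comp_add Habs Hcomplete z (abs1 Habs)) //.
  rewrite (comp_opp Habs Hcomplete z (abs1 Habs)) // /ps_add /ps_opp.
  by rewrite comp_psp_horner // hornerC addrC subrK.
rewrite Eut (absD_dom Habs) u0 //; apply: le_lt_trans mt.
have := comp_coef_le Habs Hcomplete (k := 0) (abs1 Habs) Et r0 zr
  (fun n _ => mu_ps_ub Habs n Et r0).
by rewrite expr0 mulr1.
Qed.

Lemma is_ord_prod_XsubC (s : seq K) z :
  is_ord abs (psp (\prod_(w <- s) ('X - w%:P))) z (count_mem z s).
Proof.
elim: s => [|w s IH].
  rewrite big_nil; split=> //; rewrite comp_psp_horner // hornerC; exact: oner_neq0.
rewrite big_cons psp_mul /= eq_sym; apply: is_ord_mul => //.
- exact: psp_entire.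
- exact: psp_entire.
- exact: is_ord_XsubC.
Qed.

(** The lowest coefficient is, up to sign, the product of the non-zero roots; a root at the origin
    contributes [ln 0 = 0] to the sum. *)
Lemma ln_low_prod_XsubC (s : seq K) : exists2 j,
  low_index (psp (\prod_(w <- s) ('X - w%:P))) j &
  ln (abs (psp (\prod_(w <- s) ('X - w%:P)) j)) = \sum_(w <- s) ln (abs w).
Proof.
elim: s => [|w s [j Hj Ej]].
  exists 0%N; last by rewrite !big_nil /psp coef1 (abs1 Habs) ln1.
  by rewrite big_nil; split=> //; rewrite /psp coef1 oner_eq0.
have Hw : low_index (psp ('X - w%:P)) (w == 0).
  rewrite /low_index /psp; case: eqP => [->|/eqP w0].
    by split=> [[]//|]; rewrite subr0 coefX // oner_eq0.
  by split=> //; rewrite coefB coefX coefC sub0r oppr_eq0.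
exists ((w == 0%R) + j)%N; rewrite !big_cons psp_mul; first exact: low_index_mul.
rewrite (low_index_mulE Hw Hj) (absM Habs) lnM ?posrE ?(abs_gt0 Habs);
  [|by case: Hw|by case: Hj].
rewrite Ej; congr (_ + _); rewrite /psp; case: eqP => [->|/eqP w0].
  by rewrite subr0 coefX (abs1 Habs) (abs0 Habs) ln1 ln0.
by rewrite coefB coefX coefC sub0r (absN Habs).
Qed.

(* Jensen's formula; [ln 0 = 0] makes the summand [ln r] at a zero located at
   the origin. *)
Lemma jensen g : entire abs g -> g <> ps0 K -> exists C, forall r, 0 < r ->
  exists s : seq K, [/\ all (fun w => abs w <= r) s,
    forall z, abs z <= r -> ord abs g z = count_mem z s &
    ln (mu_ps abs r g) = \sum_(w <- s) (ln r - ln (abs w)) + C].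
Proof.
move=> Eg g0; have [n gn] := ps_neq0 g0; have [k lg] := low_index_exists gn.
(* The constant comes from the lowest non-zero coefficient of [g], hence is independent of [r],
   although the factorization is not. *)
exists (ln (abs (g k))) => r r0.
have [l tg] := top_index_exists Habs Eg r0 gn.
have [s [u [sr Eu tu Egu]]] := disc_factor Eg r0 tg.
have EP := psp_entire Habs (\prod_(w <- s) ('X - w%:P)).
exists s; split=> // [z zr|].
  apply: ord_eq; rewrite Egu -[count_mem z s]addn0; apply: is_ord_mul => //.
    exact: is_ord_prod_XsubC.
  exact: is_ord_top0 tu zr.
have [j lP EPj] := ln_low_prod_XsubC s.
have u0 : abs (u 0%N) = mu_ps abs r u by case: tu; rewrite expr0 mulr1.
have mu0 := top_index_neq0 Habs Eu r0 tu.
have lu : low_index u 0 by split=> //; rewrite -(abs_gt0 Habs) u0.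
have := low_index_mul lP lu; rewrite -Egu => /(low_index_unique lg) ->.
rewrite Egu (low_index_mulE lP lu) (mu_psM Habs) // (absM Habs) u0.
have [mP _] := prod_XsubC_top_index Habs s r0.
have mPE : mu_ps abs r (psp (\prod_(w <- s) ('X - w%:P))) = r ^+ size s.
  rewrite mP; elim: s sr {Egu EP lP EPj mP} => [|w s IH] /=.
    by rewrite !big_nil.
  by move=> /andP[wr sr]; rewrite !big_cons IH // max_l // exprS.
rewrite mPE !lnM ?posrE ?exprn_gt0 // ?(abs_gt0 Habs); last by case: lP.
rewrite EPj lnXn // sumrB addrA; congr (_ + _).
by rewrite subrK big_const_seq count_predT iter_addr addr0.
Qed.

End Zeros.

(** * The counting function of poles *)

Section Integral.
Local Open Scope classical_set_scope.
Variable R : realType.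
Local Notation mu := (@lebesgue_measure R).
Import numFieldNormedType.Exports.

(** Contribution of a simple pole of absolute value [c] to (n(t) - n(0)) / t. A pole at the origin
    cancels against n(0), hence the condition [0 < c]. *)
Definition inv_from (c t : R) : R := if (0 < c) && (c <= t) then t^-1 else 0.

Lemma inv_from_integral (c r : R) : 0 <= c -> c <= r -> 0 < r ->
  mu.-integrable `]0, r] (EFin \o inv_from c) /\
  (\int[mu]_(t in `]0, r]) inv_from c t = if 0 < c then ln r - ln c else 0)%R.
Proof.
move=> c0 cr r0; have [c_pos|c_npos] := ltP 0 c; last first.
  have E : inv_from c = cst 0 by apply/funext => t; rewrite /inv_from ltNge c_npos.
  rewrite E; split; last by rewrite Rintegral_cst ?mul0r.
  by rewrite (_ : EFin \o _ = cst 0%E) //; apply: integrable0.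
have E : {in (`]0, r]%classic : set R), inv_from c =1 ((fun t : R => (t^-1 : R)) \_ `[c, r]%classic)}.
  move=> t; rewrite inE /= in_itv /= => /andP[t0 tr].
  rewrite /inv_from patchE c_pos /=; case: ifPn => ct.
    by rewrite mem_set //= in_itv /= ct tr.
  by rewrite memNset //= in_itv /= (negbTE ct).
have sub : (`[c, r] `<=` `]0, r])%classic.
  by move=> t /=; rewrite !in_itv /= => /andP[ct ->]; rewrite (lt_le_trans c_pos ct).
have cont : {within `[c, r]%classic, continuous (fun t : R => (t^-1 : R))}.
  apply: continuous_in_subspaceT => t; rewrite inE /= in_itv /= => /andP[ct _].
  by apply: inv_continuous; rewrite gt_eqF // (lt_le_trans c_pos ct).
have int : mu.-integrable `[c, r] (EFin \o (fun t : R => (t^-1 : R))).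
  by apply: continuous_compact_integrable => //; apply: segment_compact.
split.
  suff H : mu.-integrable `]0, r] (EFin \o ((fun t : R => (t^-1 : R)) \_ `[c, r]%classic)).
    by apply: eq_integrable H => // t /E /= ->.
  rewrite -restrict_EFin; apply/integrable_restrict => //=.
  by rewrite setIC setIidl.
transitivity (\int[mu]_(t in `]0%R, r]) ((fun t : R => (t^-1 : R)) \_ `[c, r]%classic) t)%R.
  by apply: eq_Rintegral => t /E.
rewrite -Rintegral_mkcondr setIidr // /Rintegral.
(* The fundamental theorem of calculus is applied on a non-degenerate segment; for c = r both sides
   are 0. *)
have [cr'|rc] := ltP c r; last first.
  have -> : r = c by apply/eqP; rewrite eq_le rc.
  by rewrite set_itv1 integral_set1 subrr.
rewrite (@continuous_FTC2 _ _ (@ln R)) //.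
  split.
  - by move=> t; rewrite in_itv /= => /andP[ct _]; apply: ex_derive; apply: is_derive1_ln;
      apply: lt_trans ct.
  - by apply: cvg_at_right_filter; apply: continuous_ln.
  - by apply: cvg_at_left_filter; apply: continuous_ln.
move=> t; rewrite in_itv /= => /andP[ct _]; rewrite derive1E.
have := @is_derive1_ln R t (lt_trans c_pos ct); move=> [_ ->] //.
Qed.

Lemma Rintegral_sum_seq (I : Type) (s : seq I) (F : I -> R -> R) (D : set R) :
  measurable D -> (forall i, mu.-integrable D (EFin \o F i)) ->
  (\int[mu]_(t in D) (\sum_(i <- s) F i t) = \sum_(i <- s) \int[mu]_(t in D) F i t)%R.
Proof.
move=> mD iF; elim: s => [|i s IH].
  rewrite big_nil; under eq_Rintegral do rewrite big_nil.
  by rewrite Rintegral_cst ?mul0r.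
rewrite big_cons -IH; under eq_Rintegral do rewrite big_cons.
rewrite RintegralD //.
rewrite (_ : EFin \o _ = (fun t => \sum_(j <- s) (F j t)%:E)%E); last first.
  by apply/funext => t /=; rewrite sumEFin.
by apply: integrable_sum => // j _; apply: iF.
Qed.

End Integral.

(** Only the non-zero terms of the first list must occur in the second; this compares an arbitrary
    list of points with one containing all poles. *)
Lemma ler_sum_subseq (T : eqType) (R : numDomainType) (s1 s2 : seq T) (F : T -> R) :
  uniq s1 -> uniq s2 -> (forall z, z \in s2 -> 0 <= F z) ->
  (forall z, z \in s1 -> F z != 0 -> z \in s2) ->
  \sum_(z <- s1) F z <= \sum_(z <- s2) F z.
Proof.
move=> u1 u2 F0 sub; rewrite (bigID (mem s2)) /= [X in _ + X]big1_seq ?addr0; last first.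
  by move=> z /andP[zn zs]; apply/eqP; apply: contraNT zn => /(sub z zs).
rewrite (bigID (mem s1) xpredT) /= -[leLHS]addr0 lerD //; last first.
  by rewrite big_seq_cond sumr_ge0 // => z /andP[/F0].
rewrite -[leLHS]big_filter -[leRHS]big_filter le_eqVlt; apply/orP; left; apply/eqP/perm_big.
apply: uniq_perm; rewrite ?filter_uniq // => z; rewrite !mem_filter /=.
by rewrite andbC.
Qed.

(** * N(r, F) as a finite sum over poles *)

Section Counting.
Variables (K : closedFieldType) (R : realType) (abs : K -> R).
Hypotheses (Habs : nonarch_abs abs) (Hcomplete : completeK abs).
Implicit Types (F : mero K) (z w : K) (r t : R).

Let abs_ge0' := abs_ge0 Habs.
Hint Resolve abs_ge0' : core.
Local Open Scope classical_set_scope.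

Lemma is_mero_den_neq0 F : is_mero abs F -> F.2 <> ps0 K.
Proof. by case=> _ _ [n Fn] E; move: Fn; rewrite E eqxx. Qed.

(** Poles are among the zeros of the denominator, which Jensen's formula lists inside the disc. *)
Lemma pole_mult_support F r : is_mero abs F -> 0 < r ->
  exists2 s : seq K, uniq s /\ all (fun z => abs z <= r) s &
    forall z, abs z <= r -> pole_mult abs F z != 0%N -> z \in s.
Proof.
move=> MF r0; have [_ E2 _] := MF.
have [C /(_ r r0)[s [sr so _]]] := jensen Habs Hcomplete E2 (is_mero_den_neq0 MF).
exists (undup s).
  split; first exact: undup_uniq.
  by apply/allP => z; rewrite mem_undup => /(allP sr).
move=> z zr; rewrite mem_undup -has_pred1 has_count -(so z zr) /pole_mult.
by case: ord.
Qed.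

Lemma npolesE F t r (s : seq K) : 0 < r -> t <= r -> uniq s ->
  (forall z, abs z <= r -> pole_mult abs F z != 0%N -> z \in s) ->
  npoles abs t F = \sum_(z <- s | abs z <= t) (pole_mult abs F z)%:R.
Proof.
move=> r0 tr us supp; rewrite -big_filter.
set s' := [seq z <- s | abs z <= t].
have us' : uniq s' by rewrite filter_uniq.
have s't : all (fun z => abs z <= t) s' by apply: filter_all.
apply/eqP; rewrite eq_le; apply/andP; split.
  apply: ge_sup => [|_ [s1 /= [u1 s1t] <-]].
    by exists (\sum_(z <- s') pole_mult abs F z)%:R, s'.
  rewrite natr_sum; apply: ler_sum_subseq => // z zs.
  have zt := allP s1t z zs; rewrite pnatr_eq0 mem_filter zt /=.
  by apply: supp; apply: le_trans tr.
apply: ub_le_sup; last by exists s'; rewrite ?natr_sum.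
exists (\sum_(z <- s') (pole_mult abs F z)%:R) => _ [s1 /= [u1 s1t] <-].
rewrite natr_sum; apply: ler_sum_subseq => // z zs.
have zt := allP s1t z zs; rewrite pnatr_eq0 mem_filter zt /=.
by apply: supp; apply: le_trans tr.
Qed.

Lemma NcountE F r (s : seq K) : 0 < r -> uniq s -> all (fun z => abs z <= r) s ->
  (forall z, abs z <= r -> pole_mult abs F z != 0%N -> z \in s) ->
  Ncount abs r F = \sum_(z <- s) (pole_mult abs F z)%:R * (ln r - ln (abs z)).
Proof.
move=> r0 us sr supp; pose pm z : R := (pole_mult abs F z)%:R.
have E0 : npoles abs 0 F = \sum_(z <- s) pm z * (abs z <= 0)%R%:R.
  rewrite (npolesE r0 (ltW r0) us supp) big_mkcond; apply: eq_bigr => z _.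
  by case: ifP; rewrite ?mulr1 ?mulr0.
have Et t : 0 < t -> t <= r -> (npoles abs t F - npoles abs 0 F) / t =
    \sum_(z <- s) pm z * inv_from (abs z) t.
  move=> t0 tr; rewrite E0 (npolesE r0 tr us supp) big_mkcond -sumrB mulr_suml.
  apply: eq_bigr => z _; rewrite /inv_from -/(pm z).
  have [z0|z0] := ltP 0 (abs z); first by case: ifP; rewrite /= ?(mulr0, mul0r, subr0).
  by rewrite (le_trans z0 (ltW t0)) mulr1 subrr mul0r mulr0.
rewrite /Ncount.
transitivity ((\int[@lebesgue_measure R]_(t in `]0%R, r]) \sum_(z <- s) pm z * inv_from (abs z) t)%R
   + npoles abs 0 F * ln r).
  congr (_ + _); apply: eq_Rintegral => t; rewrite inE /= in_itv /= => /andP[t0 tr].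
  exact: Et.
(* The sum-integral exchange asks for integrability at every [z], not only at listed ones; clipping
   at [r] provides it and changes nothing on [s]. *)
pose c z := Num.min (abs z) r.
have cz z : z \in s -> c z = abs z by move=> /(allP sr) zr; rewrite /c min_l.
have cP z : 0 <= c z /\ c z <= r by rewrite /c le_min ge_min lexx orbT (ltW r0) andbT.
have Ic z := inv_from_integral (cP z).1 (cP z).2 r0.
transitivity ((\int[@lebesgue_measure R]_(t in `]0%R, r]) \sum_(z <- s) pm z * inv_from (c z) t)%R
   + npoles abs 0 F * ln r).
  congr (_ + _); apply: eq_Rintegral => t _; rewrite big_seq [RHS]big_seq.
  by apply: eq_bigr => z zs; rewrite cz.
rewrite Rintegral_sum_seq //; last first.
  by move=> z; apply: (integrableZl _ (pm z) (Ic z).1); apply: measurable_itv.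
rewrite E0 mulr_suml -big_split /= big_seq [RHS]big_seq; apply: eq_bigr => z zs.
rewrite RintegralZl //; last exact: (Ic z).1.
rewrite (Ic z).2 cz // -mulrA -mulrDr; congr (_ * _).
have [z0|z0] := ltP 0 (abs z); first by rewrite mul0r addr0.
(* A pole at the origin contributes nothing to the integral; its share is the [n(0) ln r] term,
   which equals ln r - ln 0 because [ln 0 = 0]. *)
have -> : abs z = 0 by apply/eqP; rewrite eq_le z0 /=.
by rewrite (ln0 (lexx 0)) mul1r add0r subr0.
Qed.

Lemma Ncount_ge F r (s : seq K) : is_mero abs F -> 1 <= r ->
  uniq s -> all (fun z => abs z <= r) s ->
  \sum_(z <- s) (pole_mult abs F z)%:R * (ln r - ln (abs z)) <= Ncount abs r F.
Proof.
move=> MF r1 us sr; have r0 : 0 < r by apply: lt_le_trans r1.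
have [s' [us' sr'] supp] := pole_mult_support MF r0.
rewrite (NcountE r0 us' sr' supp); apply: ler_sum_subseq => // z zs.
  rewrite mulr_ge0 // subr_ge0; have zr := allP sr' z zs.
  have [->|z0] := eqVneq (abs z) 0; first by rewrite ln0 // ln_ge0.
  by rewrite ler_ln ?posrE // lt_def z0 /=.
rewrite mulf_eq0 negb_or pnatr_eq0 => /andP[pz _]; apply: supp => //.
exact: (allP sr).
Qed.

End Counting.

(** * Pole bounds and growth *)

Section PoleBounds.
Variables (K : closedFieldType) (R : realType) (abs : K -> R).
Hypotheses (Habs : nonarch_abs abs) (Hcomplete : completeK abs).
Implicit Types (F G : mero K) (g h : ps K) (z w : K) (r t : R) (d : K -> nat).

Let abs_ge0' := abs_ge0 Habs.
Hint Resolve abs_ge0' : core.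

(** Unlike [ord], which is an arbitrary choice for the zero series, this stays meaningful when
    cancellation produces zero, and it is preserved by sums. *)
Definition vanishes_to g z k := forall i, (i < k)%N -> ps_comp_aff abs 1 z g i = 0.

Lemma vanishes_toW g z k l : (l <= k)%N -> vanishes_to g z k -> vanishes_to g z l.
Proof. by move=> lk gk i il; apply: gk; apply: leq_trans lk. Qed.

Lemma vanishes_to_ord g z k : entire abs g -> g <> ps0 K ->
  vanishes_to g z k <-> (k <= ord abs g z)%N.
Proof.
move=> Eg g0; have [go go0] := ordP Habs Hcomplete z Eg g0; split=> [gk|ko i ik].
  by rewrite leqNgt; apply/negP => /gk E; rewrite E eqxx in go0.
by apply: go; apply: leq_trans ko.
Qed.

Lemma vanishes_to0 z k : vanishes_to (ps0 K) z k.
Proof.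
move=> i _; rewrite -psp0 (comp_psp_translate Habs) comp_poly0.
by rewrite /psp coef0.
Qed.

Lemma vanishes_to_add g h z k : entire abs g -> entire abs h ->
  vanishes_to g z k -> vanishes_to h z k -> vanishes_to (ps_add g h) z k.
Proof.
move=> Eg Eh gk hk i ik; rewrite (comp_add Habs Hcomplete z (abs1 Habs)) //.
by rewrite /ps_add gk // hk // addr0.
Qed.

Lemma vanishes_to_opp g z k : entire abs g ->
  vanishes_to g z k -> vanishes_to (ps_opp g) z k.
Proof.
move=> Eg gk i ik; rewrite (comp_opp Habs Hcomplete z (abs1 Habs)) //.
by rewrite /ps_opp gk // oppr0.
Qed.

Lemma vanishes_to_mul g h z k l : entire abs g -> entire abs h ->
  vanishes_to g z k -> vanishes_to h z l -> vanishes_to (ps_mul g h) z (k + l).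
Proof.
move=> Eg Eh gk hl i ikl; rewrite (comp_mul Habs Hcomplete z (abs1 Habs)) //.
rewrite /ps_mul big1 // => j _; have [jk|kj] := ltnP j k; first by rewrite gk // mul0r.
by rewrite hl ?mulr0 //; have := ltn_ord j; lia.
Qed.

(* [F] has at each point a pole of order at most [d]; quotients are not
   required to be reduced. *)
Definition poles_le F d :=
  forall z k, vanishes_to F.2 z k -> vanishes_to F.1 z (k - d z).

Lemma is_mero_add F G : is_mero abs F -> is_mero abs G -> is_mero abs (mero_add F G).
Proof.
move=> MF MG; have [F1 F2 _] := MF; have [G1 G2 _] := MG; split=> /=.
- by apply: ps_add_entire => //; apply: ps_mul_entire.
- exact: ps_mul_entire.
- by apply: ps_neq0 => /(ps_mul_eq0 Habs F2 G2)[/(is_mero_den_neq0 MF)|/(is_mero_den_neq0 MG)].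
Qed.

Lemma is_mero_mul F G : is_mero abs F -> is_mero abs G -> is_mero abs (mero_mul F G).
Proof.
move=> MF MG; have [F1 F2 _] := MF; have [G1 G2 _] := MG; split=> /=.
- exact: ps_mul_entire.
- exact: ps_mul_entire.
- by apply: ps_neq0 => /(ps_mul_eq0 Habs F2 G2)[/(is_mero_den_neq0 MF)|/(is_mero_den_neq0 MG)].
Qed.

Lemma is_mero_opp F : is_mero abs F -> is_mero abs (mero_opp F).
Proof. by move=> [F1 F2 F0]; split=> //=; apply: ps_opp_entire. Qed.

Lemma is_mero_comp al be F : abs al = 1 -> is_mero abs F ->
  is_mero abs (mero_comp abs al be F).
Proof.
move=> Hal MF; have [F1 F2 _] := MF; split=> /=; try exact: comp_entire.
apply: ps_neq0; apply: comp_neq0 => //; exact: (is_mero_den_neq0 MF).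
Qed.

Lemma is_mero0 : is_mero abs (mero0 K).
Proof.
split; [exact: ps0_entire|exact: ps1_entire|]; by exists 0%N; rewrite oner_eq0.
Qed.

Lemma is_mero1 : is_mero abs (mero1 K).
Proof.
split; [exact: ps1_entire|exact: ps1_entire|]; by exists 0%N; rewrite oner_eq0.
Qed.

Lemma poles_le_ord F d z : is_mero abs F -> poles_le F d ->
  vanishes_to F.1 z (ord abs F.2 z - d z).
Proof.
move=> MF; apply; have [_ F2 _] := MF.
by apply/vanishes_to_ord => //; apply: (is_mero_den_neq0 MF).
Qed.

Lemma poles_le_pole_mult F : is_mero abs F -> poles_le F (pole_mult abs F).
Proof.
move=> MF z k; have [F1 F2 _] := MF; have F20 := is_mero_den_neq0 MF.
move=> /(vanishes_to_ord z k F2 F20) k2.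
have [->|F10] := pselect (F.1 = ps0 K); first exact: vanishes_to0.
by apply/vanishes_to_ord => //; rewrite /pole_mult; lia.
Qed.

Lemma poles_le0 : poles_le (mero0 K) (fun=> 0%N).
Proof. by move=> z k _; apply: vanishes_to0. Qed.

Lemma poles_le1 : poles_le (mero1 K) (fun=> 0%N).
Proof. by move=> z k; rewrite subn0. Qed.

Lemma poles_le_opp F d : is_mero abs F -> poles_le F d -> poles_le (mero_opp F) d.
Proof. by move=> [F1 _ _] Fd z k Fk; apply: vanishes_to_opp => //; apply: Fd. Qed.

Lemma poles_le_mul F G d d' : is_mero abs F -> is_mero abs G ->
  poles_le F d -> poles_le G d' -> poles_le (mero_mul F G) (fun z => d z + d' z)%N.
Proof.
move=> MF MG Fd Gd z k; have [F1 F2 _] := MF; have [G1 G2 _] := MG.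
have oF := ordP Habs Hcomplete z F2 (is_mero_den_neq0 MF).
have oG := ordP Habs Hcomplete z G2 (is_mero_den_neq0 MG).
have [_ M2 _] := is_mero_mul MF MG.
move=> /(vanishes_to_ord z k M2 (is_mero_den_neq0 (is_mero_mul MF MG))).
rewrite (ord_eq (is_ord_mul Habs Hcomplete F2 G2 oF oG)) => kFG.
refine (vanishes_toW _ (vanishes_to_mul F1 G1 (poles_le_ord (z := z) MF Fd) (poles_le_ord (z := z) MG Gd))).
lia.
Qed.

(** Over the common denominator each of the two numerators loses at most [d] or [d'] orders. The sum
    is cruder than the maximum but keeps the weight small. *)
Lemma poles_le_add F G d d' : is_mero abs F -> is_mero abs G ->
  poles_le F d -> poles_le G d' -> poles_le (mero_add F G) (fun z => d z + d' z)%N.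
Proof.
move=> MF MG Fd Gd z k; have [F1 F2 _] := MF; have [G1 G2 _] := MG.
have F20 := is_mero_den_neq0 MF; have G20 := is_mero_den_neq0 MG.
have oF := ordP Habs Hcomplete z F2 F20; have oG := ordP Habs Hcomplete z G2 G20.
have [_ M2 _] := is_mero_mul MF MG.
move=> /(vanishes_to_ord z k M2 (is_mero_den_neq0 (is_mero_mul MF MG))).
rewrite (ord_eq (is_ord_mul Habs Hcomplete F2 G2 oF oG)) => kFG.
have vF : vanishes_to F.2 z (ord abs F.2 z) by apply/vanishes_to_ord.
have vG : vanishes_to G.2 z (ord abs G.2 z) by apply/vanishes_to_ord.
apply: vanishes_to_add; try exact: ps_mul_entire.
  refine (vanishes_toW _ (vanishes_to_mul F1 G2 (poles_le_ord (z := z) MF Fd) vG)); lia.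
refine (vanishes_toW _ (vanishes_to_mul G1 F2 (poles_le_ord (z := z) MG Gd) vF)); lia.
Qed.

Lemma vanishes_to_comp al be g z k : abs al = 1 -> entire abs g ->
  vanishes_to (ps_comp_aff abs al be g) z k <-> vanishes_to g (al * z + be) k.
Proof.
move=> Hal Eg; have al0 : al != 0 by rewrite -(abs_gt0 Habs) Hal.
have E1 := abs1 Habs.
(* Expanding at [z] after substitution amounts to expanding [g] at the image of [z] and then scaling
   by [al], which multiplies coefficient [i] by the non-zero factor [al ^+ i]. *)
have E : ps_comp_aff abs 1 z (ps_comp_aff abs al be g) =
         ps_comp_aff abs al 0 (ps_comp_aff abs 1 (al * z + be) g).
  by rewrite !(comp_comp Habs Hcomplete) // mulr1 mul1r mul1r add0r.
have Ec i : ps_comp_aff abs 1 z (ps_comp_aff abs al be g) i =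
    ps_comp_aff abs 1 (al * z + be) g i * al ^+ i.
  rewrite E /ps_comp_aff (@ssum_fin _ _ _ Habs _ 1).
    by rewrite big_ord_recl big_ord0 addr0 expr0 mulr1 add0n binn mulr1.
  by case=> // n _; rewrite expr0n mulr0.
split=> H i ik; last by rewrite Ec H // mul0r.
have /eqP := H i ik; rewrite Ec mulf_eq0 expf_eq0 (negbTE al0) andbF orbF.
by move/eqP.
Qed.

Lemma poles_le_comp al be F d : abs al = 1 -> is_mero abs F -> poles_le F d ->
  poles_le (mero_comp abs al be F) (fun z => d (al * z + be)).
Proof.
move=> Hal [F1 F2 _] Fd z k /= /(vanishes_to_comp be z k Hal F2) Fk.
by apply/vanishes_to_comp => //; apply: Fd.
Qed.

Lemma sum_count_undup (s : seq K) (f : K -> R) :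
  \sum_(z <- s) f z = \sum_(z <- undup s) (count_mem z s)%:R * f z.
Proof.
rewrite -big_undup_iterop_count; apply: eq_bigr => z _.
by rewrite mulr_natl -[RHS]/(iterop _ +%R _ 0).
Qed.

(* Jensen's inequality: [F^-1] is controlled by the poles of [F]. *)
Lemma poles_le_lower F d : is_mero abs F -> F.1 <> ps0 K -> poles_le F d ->
  exists C, forall r, 1 <= r -> exists s : seq K,
    [/\ uniq s, all (fun z => abs z <= r) s &
     ln (mu_ps abs r F.2) - ln (mu_ps abs r F.1)
       <= \sum_(z <- s) (d z)%:R * (ln r - ln (abs z)) + C].
Proof.
move=> MF F10 Fd; have [F1 F2 _] := MF; have F20 := is_mero_den_neq0 MF.
have [C1 J1] := jensen Habs Hcomplete F1 F10.
have [C2 J2] := jensen Habs Hcomplete F2 F20.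
exists (C2 - C1) => r r1; have r0 : 0 < r by apply: lt_le_trans r1.
have [s1 [sr1 so1 ->]] := J1 r r0; have [s2 [sr2 so2 ->]] := J2 r r0.
have sr2' : all (fun z => abs z <= r) (undup s2).
  by apply/allP => z; rewrite mem_undup => /(allP sr2).
exists (undup s2); split=> //; first exact: undup_uniq.
pose w z := ln r - ln (abs z).
have w0 z : abs z <= r -> 0 <= w z.
  move=> zr; rewrite subr_ge0.
  have [->|z0] := eqVneq (abs z) 0; first by rewrite (ln0 (lexx 0)) ln_ge0.
  by rewrite ler_ln ?posrE // lt_def z0 /=.
(* Zeros of the numerator away from those of the denominator only help and are dropped. At a zero of
   the denominator, its order is at most [d] plus the order of the numerator, which gives [H2]. *)
have H1 : \sum_(z <- undup s2) (count_mem z s1)%:R * w z <= \sum_(z <- s1) w z.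
  rewrite (sum_count_undup s1); apply: ler_sum_subseq; rewrite ?undup_uniq //.
    by move=> z; rewrite mem_undup => zs; rewrite mulr_ge0 // w0 // (allP sr1).
  move=> z _; rewrite mulf_eq0 negb_or pnatr_eq0 mem_undup => /andP[+ _].
  by rewrite -lt0n -has_count has_pred1.
have H2 : \sum_(z <- s2) w z <=
    \sum_(z <- undup s2) (d z)%:R * w z + \sum_(z <- undup s2) (count_mem z s1)%:R * w z.
  rewrite -big_split /= (sum_count_undup s2) [leLHS]big_seq [leRHS]big_seq; apply: ler_sum => z zs.
  have zr := allP sr2' z zs.
  rewrite -mulrDl ler_wpM2r ?w0 // -natrD ler_nat -so1 // -so2 //.
  have /(vanishes_to_ord z (ord abs F.2 z - d z) F1 F10) := poles_le_ord (z := z) MF Fd.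
  lia.
suff : \sum_(z <- s2) w z + C2 - (\sum_(z <- s1) w z + C1) <=
  \sum_(z <- undup s2) (d z)%:R * w z + (C2 - C1) by [].
move: H1 H2; lra.
Qed.

End PoleBounds.

(** * Gauss norm of quotients and unboundedness of T(r, f) *)

Section MeroNorm.
Variables (K : closedFieldType) (R : realType) (abs : K -> R).
Hypotheses (Habs : nonarch_abs abs) (Hcomplete : completeK abs).
Implicit Types (F G : mero K) (r M : R).

Lemma mu_den_gt0 F r : is_mero abs F -> 0 < r -> 0 < mu_ps abs r F.2.
Proof.
move=> MF r0; have [_ E2 _] := MF; have [n] := ps_neq0 (is_mero_den_neq0 MF).
exact: mu_ps_gt0.
Qed.

Lemma mu_ge0 F r : is_mero abs F -> 0 < r -> 0 <= mu abs r F.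
Proof. by move=> [E1 E2 _] r0; rewrite divr_ge0 // mu_ps_ge0. Qed.

Lemma mu_mul F G r : is_mero abs F -> is_mero abs G -> 0 < r ->
  mu abs r (mero_mul F G) = mu abs r F * mu abs r G.
Proof.
by move=> [F1 F2 _] [G1 G2 _] r0; rewrite /mu /= !(mu_psM Habs) // mulf_div.
Qed.

Lemma mu_opp F r : mu abs r (mero_opp F) = mu abs r F.
Proof. by rewrite /mu /= (mu_psN Habs). Qed.

Lemma mu_le F r M : is_mero abs F -> 0 < r ->
  (mu abs r F <= M) = (mu_ps abs r F.1 <= M * mu_ps abs r F.2).
Proof. by move=> MF r0; rewrite /mu ler_pdivrMr // mu_den_gt0. Qed.

Lemma mu_add_le F G r M : is_mero abs F -> is_mero abs G -> 0 < r ->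
  mu abs r F <= M -> mu abs r G <= M -> mu abs r (mero_add F G) <= M.
Proof.
move=> MF MG r0; have MFG := is_mero_add Habs MF MG.
have [F1 F2 _] := MF; have [G1 G2 _] := MG.
have mF := mu_ps_ge0 Habs F2 r0; have mG := mu_ps_ge0 Habs G2 r0.
rewrite !mu_le // /= => FM GM; apply: (mu_psD_le Habs) => //; try exact: ps_mul_entire.
  by rewrite !(mu_psM Habs) // mulrA; apply: ler_wpM2r.
by rewrite !(mu_psM Habs) // [_ * mu_ps _ _ G.2]mulrC mulrA; apply: ler_wpM2r.
Qed.

Lemma mu_comp_aff al be F r : abs al = 1 -> is_mero abs F -> 0 < r -> abs be <= r ->
  mu abs r (mero_comp abs al be F) = mu abs r F.
Proof. by move=> Hal [F1 F2 _] r0 ber; rewrite /mu /= !(comp_mu Habs Hcomplete). Qed.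

Lemma mu_mero0 r : mu abs r (mero0 K) = 0.
Proof. by rewrite /mu /= (mu_ps0 Habs) mul0r. Qed.

Lemma mu_mero1 r : 0 < r -> mu abs r (mero1 K) = 1.
Proof.
move=> r0; rewrite /mu /= -psp1 -polyC1.
have [_ ->] := pspC_top_index Habs (oner_neq0 K) r0.
by rewrite (abs1 Habs) divr1.
Qed.

Lemma logp_ge0 (x : R) : 0 <= logp x.
Proof. by rewrite /logp le_max lexx. Qed.

Lemma logp_ln (x : R) : ln x <= logp x.
Proof. by rewrite /logp le_max lexx orbT. Qed.

Lemma logp_le (x y : R) : x <= y -> logp x <= logp y.
Proof.
move=> xy; rewrite {1}/logp ge_max logp_ge0 /=; have [x0|x0] := ltP 0 x.
  by apply: le_trans (logp_ln y); rewrite ler_ln ?posrE // (lt_le_trans x0).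
by rewrite ln0 // logp_ge0.
Qed.

Lemma logpM (x y : R) : 0 <= x -> 0 <= y -> logp (x * y) <= logp x + logp y.
Proof.
move=> x0 y0; have [xg yg] := (logp_ge0 x, logp_ge0 y).
rewrite {1}/logp ge_max addr_ge0 //=.
have [->|xn0] := eqVneq x 0; first by rewrite mul0r (ln0 (lexx 0)) addr_ge0 ?logp_ge0.
have [->|yn0] := eqVneq y 0; first by rewrite mulr0 (ln0 (lexx 0)) addr_ge0 ?logp_ge0.
by rewrite lnM ?posrE ?lt_def ?xn0 ?yn0 // lerD ?logp_ln.
Qed.

Lemma Ncount_ge0 F r : is_mero abs F -> 1 <= r -> 0 <= Ncount abs r F.
Proof.
move=> MF r1; have := Ncount_ge Habs Hcomplete (s := [::]) MF r1 isT isT.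
by rewrite big_nil.
Qed.

Lemma mprox_le_Tchar F r : is_mero abs F -> 1 <= r -> mprox abs r F <= Tchar abs r F.
Proof. by move=> MF r1; rewrite lerDl Ncount_ge0. Qed.

Lemma Ncount_le_Tchar F r : is_mero abs F -> 1 <= r -> Ncount abs r F <= Tchar abs r F.
Proof. by move=> MF r1; rewrite lerDr logp_ge0. Qed.

Lemma ln_gt (x r : R) : expR x < r -> x < ln r.
Proof.
by move=> xr; rewrite -[x]expRK ltr_ln ?posrE ?expR_gt0 // (lt_trans _ xr) ?expR_gt0.
Qed.

Lemma ps_mulC_coef (c : K) (g : ps K) i : ps_mul (psp c%:P) g i = c * g i.
Proof.
rewrite /ps_mul big_ord_recl /psp coefC /= subn0 big1 ?addr0 // => j _.
by rewrite coefC /= mul0r.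
Qed.

(* If [f] has no pole, subtracting its value at the origin creates a zero, and
   Jensen's formula makes the norm grow at least like [r]. *)
Lemma Tchar_unbounded f : is_mero abs f -> ~ mero_const f ->
  forall M, exists r0, forall r, r0 < r -> M <= Tchar abs r f.
Proof.
move=> Mf fnc M; have [f1 f2 _] := Mf; have f20 := is_mero_den_neq0 Mf.
have [[z0 pz]|nopole] := pselect (exists z, pole_mult abs f z != 0%N).
  (* A single pole already gives N(r, f) >= ln r - ln |z0|, which is at least [M] beyond this
     radius. *)
  exists (Num.max 1 (Num.max (abs z0) (expR (M + ln (abs z0))))) => r.
  rewrite !gt_max => /and3P[/ltW r1 /ltW zr /ln_gt Mr].
  apply: le_trans (Ncount_le_Tchar Mf r1).
  apply: le_trans (Ncount_ge Habs Hcomplete (s := [:: z0]) Mf r1 isT _); last by rewrite /= zr.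
  rewrite big_seq1 -[leLHS]mul1r.
  have [M0|M0] := ltP M 0; last first.
    by apply: ler_pM; rewrite ?ler01 //; [rewrite ler1n lt0n | lra].
  rewrite mul1r (le_trans (ltW M0)) // mulr_ge0 // subr_ge0.
  have [->|z00] := eqVneq (abs z0) 0; first by rewrite (ln0 (lexx 0)) ln_ge0.
  by rewrite ler_ln ?posrE ?(lt_le_trans _ r1) // lt_def z00 (abs_ge0 Habs).
have Pf : poles_le abs f (fun=> 0%N).
  have -> : (fun=> 0%N) = pole_mult abs f.
    apply/funext => z; apply/esym/eqP/negPn/negP => pz; apply: nopole; by exists z.
  exact: poles_le_pole_mult.
pose k := ord abs f.2 0.
have id0 g : entire abs g -> ps_comp_aff abs 1 0 g = g by apply: comp_id.
have [f2k f2k0] : (forall i, (i < k)%N -> f.2 i = 0) /\ f.2 k != 0.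
  by have := ordP Habs Hcomplete 0 f2 f20; rewrite /is_ord id0.
have f1k i : (i < k)%N -> f.1 i = 0.
  by have := poles_le_ord Habs Hcomplete (z := 0) Mf Pf; rewrite subn0 /vanishes_to id0 //; apply.
(* The value of [f] at the origin; the [k]-th coefficients are used because both components may
   vanish there. Then [p], the numerator of f - c, vanishes to order at least k + 1. *)
pose c := f.1 k / f.2 k.
pose p := ps_add f.1 (ps_mul (psp (- c)%:P) f.2).
have EC := psp_entire Habs (- c)%:P.
have Ecf : entire abs (ps_mul (psp (- c)%:P) f.2) by apply: ps_mul_entire.
have Ep : entire abs p by apply: ps_add_entire.
have pE i : p i = f.1 i - c * f.2 i by rewrite /p /ps_add ps_mulC_coef mulNr.
have p0 : p <> ps0 K.
  move=> p0; apply: fnc; exists c => n; rewrite /= ps_mulC ps_mul1 -pspC ps_mulC_coef.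
  by apply/eqP; rewrite -subr_eq0 -pE p0.
have pk i : (i < k.+1)%N -> p i = 0.
  rewrite ltnS leq_eqVlt pE => /predU1P[->|ik]; first by rewrite /c divfK ?subrr.
  by rewrite f1k // f2k // mulr0 subrr.
have [u Eu Epu] : exists2 u, entire abs u & p = ps_mul (psp ('X - 0%:P)) u.
  by apply: divide_zero => //; rewrite id0 // pk.
have u0 : u <> ps0 K.
  move=> u0; apply: p0; rewrite Epu u0; apply/funext => n.
  by rewrite /ps_mul big1 // => i _; rewrite mulr0.
have Mu : is_mero abs (u, f.2) by case: Mf.
(* Dividing [p] by ['X] creates no pole: at the origin the numerator has one order to spare, and
   elsewhere nothing changes. *)
have Pu : poles_le abs (u, f.2) (fun=> 0%N).
  move=> z l; rewrite subn0 /= => fl.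
  have ou := ordP Habs Hcomplete z Eu u0.
  have op := is_ord_mul Habs Hcomplete (psp_entire Habs _) Eu (is_ord_XsubC Habs z 0) ou.
  rewrite -Epu in op; apply/(vanishes_to_ord Habs Hcomplete z l Eu u0).
  have vp : vanishes_to abs p z l.
    apply: vanishes_to_add => //; first by have := Pf z l fl; rewrite subn0.
    have vC : vanishes_to abs (psp (- c)%:P) z 0 by move=> i.
    by have := vanishes_to_mul Habs Hcomplete EC f2 vC fl.
  have := proj1 (vanishes_to_ord Habs Hcomplete z l Ep p0) vp.
  rewrite (ord_eq op); case: eqP => [z0|_]; last by rewrite add0n.
  have : (k.+1 <= ord abs p z)%N.
    by apply/(vanishes_to_ord Habs Hcomplete z k.+1 Ep p0); rewrite z0 /vanishes_to id0.
  have := proj1 (vanishes_to_ord Habs Hcomplete z l f2 f20) fl.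
  by rewrite z0 -/k -z0 (ord_eq op) z0 eqxx /=; lia.
have [C HC] := poles_le_lower Habs Hcomplete Mu u0 Pu.
exists (Num.max 1 (Num.max (expR (M + C)) (expR (C + ln (abs c))))) => r.
rewrite !gt_max => /and3P[/ltW r1 /ln_gt Mr /ln_gt cr].
have r0 : 0 < r by apply: lt_le_trans r1.
have [s [_ _ /=]] := HC r r1.
rewrite big1 => [|z _]; last by rewrite mul0r.
rewrite add0r => Hu.
apply: le_trans (mprox_le_Tchar Mf r1); apply: le_trans (logp_ln _).
have [n un] := ps_neq0 u0; have mu0 := mu_ps_gt0 Habs Eu r0 un.
have mf2 := mu_den_gt0 Mf r0.
have mp : mu_ps abs r p = r * mu_ps abs r u.
  rewrite Epu (mu_psM Habs) ?(XsubC_mu Habs) ?(abs0 Habs) ?(ltW r0) //; exact: psp_entire.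
have lnp : ln (mu_ps abs r p) = ln r + ln (mu_ps abs r u) by rewrite mp lnM.
(* The norm of p / f.2 is at least r exp(- C). The second threshold on [r] rules out that |c|
   attains this bound, so [f] itself must be large. *)
have pmax : mu_ps abs r p <= Num.max (mu_ps abs r f.1) (abs c * mu_ps abs r f.2).
  apply: (mu_psD_le Habs) => //; first by rewrite le_max lexx.
  rewrite (mu_psM Habs) // le_max; apply/orP; right.
  apply: ler_wpM2r; first exact: ltW.
  apply: mu_ps_le => -[|i]; rewrite /psp coefC ?expr0 ?mulr1 ?(absN Habs) //=.
  by rewrite (abs0 Habs) mul0r (abs_ge0 Habs).
have mp0 : 0 < mu_ps abs r p by rewrite mp mulr_gt0.
move: pmax; rewrite le_max => /orP[pf1|pcf].
  have mf1 := lt_le_trans mp0 pf1.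
  have : ln (mu_ps abs r p) <= ln (mu_ps abs r f.1) by rewrite ler_ln.
  rewrite /mu ln_div //; lra.
have c0 : 0 < abs c.
  by have := lt_le_trans mp0 pcf; rewrite pmulr_lgt0.
have : ln (mu_ps abs r p) <= ln (abs c * mu_ps abs r f.2).
  by rewrite ler_ln ?posrE // mulr_gt0.
rewrite lnM // => lnp'.
lra.
Qed.

End MeroNorm.

(** * Functions of small characteristic *)

Section Tame.
Variables (K : closedFieldType) (R : realType) (abs : K -> R).
Hypotheses (Habs : nonarch_abs abs) (Hcomplete : completeK abs).
Variable T : R -> R.
Hypothesis T_unbounded : forall M, exists r0, forall r, r0 < r -> M <= T r.
Implicit Types (F G : mero K) (X Y : R -> R) (d : K -> nat) (s : seq K).

Let abs_ge0' := abs_ge0 Habs.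
Hint Resolve abs_ge0' : core.

Lemma eventually_and (P Q : R -> Prop) :
  (exists r0, forall r, r0 < r -> P r) -> (exists r0, forall r, r0 < r -> Q r) ->
  exists r0, forall r, r0 < r -> P r /\ Q r.
Proof.
move=> [r1 H1] [r2 H2]; exists (Num.max r1 r2) => r.
by rewrite gt_max => /andP[/H1 ? /H2].
Qed.

Lemma eventually_gt M : exists r0 : R, forall r, r0 < r -> M < r.
Proof. by exists M. Qed.

Lemma T_const_le e C : 0 < e -> exists r0, forall r, r0 < r -> C <= e * T r.
Proof.
move=> e0; have [r0 Hr] := T_unbounded (C / e); exists r0 => r /Hr.
by rewrite ler_pdivrMr // mulrC.
Qed.

(** One-sided form of [small_o]: only upper bounds are propagated, so no sign conditions have to be
    carried along. *)
Definition upper_o X := forall e : R, 0 < e ->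
  exists r0, forall r, r0 < r -> X r <= e * T r.

Lemma upper_o_le X Y : (exists r0, forall r, r0 < r -> X r <= Y r) ->
  upper_o Y -> upper_o X.
Proof.
move=> XY NY e /NY NYe; have [r0 H] := eventually_and XY NYe.
by exists r0 => r /H[]; apply: le_trans.
Qed.

Lemma upper_o_add X Y : upper_o X -> upper_o Y ->
  upper_o (fun r => X r + Y r).
Proof.
move=> NX NY e e0; have e20 : 0 < e / 2 by rewrite divr_gt0.
have [r0 H] := eventually_and (NX _ e20) (NY _ e20).
exists r0 => r /H[HX HY]; rewrite (_ : e * T r = e / 2 * T r + e / 2 * T r); last by field.
exact: lerD.
Qed.

Lemma upper_o_const C : upper_o (fun=> C).
Proof. by move=> e e0; apply: T_const_le. Qed.

(* A weight [d] whose logarithmic counting function is negligible. *)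
Definition small_weight d :=
  (forall r, exists s, forall z, abs z <= r -> d z != 0%N -> z \in s) /\
  forall e : R, 0 < e -> exists r0, forall r, r0 < r -> forall s, uniq s ->
    all (fun z => abs z <= r) s ->
    \sum_(z <- s) (d z)%:R * (ln r - ln (abs z)) <= e * T r.

Lemma small_weight0 : small_weight (fun=> 0%N).
Proof.
split=> [r|e e0]; first by exists [::].
have [r0 H] := T_const_le 0 e0; exists r0 => r /H ? s _ _.
by rewrite big1 // => z _; rewrite mul0r.
Qed.

Lemma small_weight_add d d' : small_weight d -> small_weight d' ->
  small_weight (fun z => d z + d' z)%N.
Proof.
move=> [df dN] [df' dN']; split=> [r|e e0].
  have [s Hs] := df r; have [s' Hs'] := df' r; exists (s ++ s') => z zr.
  rewrite mem_cat; have [d0|/(Hs z zr) -> //] := eqVneq (d z) 0%N.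
  by rewrite d0 add0n => /(Hs' z zr) ->; rewrite orbT.
have e20 : 0 < e / 2 by rewrite divr_gt0.
have [r0 H] := eventually_and (dN _ e20) (dN' _ e20).
exists r0 => r /H[HX HY] s us sr.
rewrite (_ : e * T r = e / 2 * T r + e / 2 * T r); last by field.
under eq_bigr do rewrite natrD mulrDl.
by rewrite big_split /= lerD ?HX ?HY.
Qed.

(* An isometric affine change of variable moves only the finitely many points
   with [|z| <= |be|] relative to the origin. *)
Lemma small_weight_comp al be d : abs al = 1 -> small_weight d ->
  small_weight (fun z => d (al * z + be)).
Proof.
move=> Hal [df dN]; have al0 : al != 0 by rewrite -(abs_gt0 Habs) Hal.
pose L z := al * z + be; pose L' w := al^-1 * (w - be).
have LK : cancel L L' by move=> z; rewrite /L /L' addrK mulKf.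
have Lr r z : abs be <= r -> abs z <= r -> abs (L z) <= r.
  by move=> ber zr; apply: (absD_le Habs) => //; rewrite (absM Habs) Hal mul1r.
have supp r : exists s, forall z, abs z <= r -> d (L z) != 0%N -> z \in s.
  have [s Hs] := df (Num.max r (abs be)); exists (map L' s) => z zr dz.
  rewrite -[z]LK map_f // Hs // Lr ?le_max ?lexx ?orbT //.
  by rewrite zr.
split=> // e e0; have e20 : 0 < e / 2 by rewrite divr_gt0.
have [s0 Hs0] := supp (abs be).
(* The error of replacing |L z| by |z|. It vanishes when |z| > |be|, where both agree, so local
   finiteness of the weight bounds its total by a constant [C]. *)
pose D z := (d (L z))%:R * (ln (abs (L z)) - ln (abs z)).
pose C := \sum_(z <- undup s0) `|D z|.
have [r0 H] := eventually_and (eventually_and (dN _ e20) (T_const_le C e20))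
  (eventually_gt (abs be)).
exists r0 => r /H[[HX HC] /ltW ber] s us sr.
rewrite (_ : e * T r = e / 2 * T r + e / 2 * T r); last by field.
rewrite (eq_bigr (fun z => (d (L z))%:R * (ln r - ln (abs (L z))) + D z)); last first.
  by move=> z _; rewrite /D /L; ring.
rewrite big_split lerD //=.
  rewrite -(big_map L xpredT (fun w => (d w)%:R * (ln r - ln (abs w)))).
  apply: HX; first by rewrite map_inj_uniq //; apply: can_inj LK.
  by rewrite all_map; apply: sub_all sr => z /=; apply: Lr.
apply: le_trans HC; apply: le_trans (ler_norm _) _.
apply: le_trans (ler_norm_sum _ _ _) _.
apply: ler_sum_subseq => //; rewrite ?undup_uniq // => z _.
rewrite normr_eq0 mem_undup /D mulf_eq0 negb_or pnatr_eq0 => /andP[dz].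
have [zb _|bz] := leP (abs z) (abs be); first exact: Hs0.
by rewrite /L (absD_dom Habs) (absM Habs) Hal mul1r ?subrr ?eqxx.
Qed.

(** Substitute for T(r, F) = o(T). Poles are controlled by a dominating weight instead of [Ncount],
    so sums, products and substitutions need no new integral. *)
Definition tame F := [/\ is_mero abs F, upper_o (fun r => mprox abs r F) &
  exists2 d, poles_le abs F d & small_weight d].

Lemma tame_Tchar F : is_mero abs F -> upper_o (fun r => Tchar abs r F) -> tame F.
Proof.
move=> MF NT; split=> //.
  apply: upper_o_le NT; exists 1 => r /ltW r1; exact: mprox_le_Tchar.
exists (pole_mult abs F); first exact: poles_le_pole_mult.
split=> [r|e e0].
  have r0 : 0 < Num.max r 1 by rewrite lt_max ltr01 orbT.
  have [s _ Hs] := pole_mult_support Habs Hcomplete MF r0; exists s => z zr.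
  by apply: Hs; rewrite le_max zr.
have [r0 H] := eventually_and (NT e e0) (eventually_gt 1).
exists r0 => r /H[HT /ltW r1] s us sr; apply: le_trans HT.
apply: le_trans (Ncount_le_Tchar MF r1); exact: Ncount_ge.
Qed.

Lemma tame_mul F G : tame F -> tame G -> tame (mero_mul F G).
Proof.
move=> [MF NF [d Fd dS]] [MG NG [d' Gd dS']]; split.
- exact: is_mero_mul.
- apply: upper_o_le (upper_o_add NF NG); exists 0 => r r0.
  by rewrite /mprox mu_mul // logpM // mu_ge0.
- exists (fun z => d z + d' z)%N; [exact: poles_le_mul | exact: small_weight_add].
Qed.

Lemma tame_add F G : tame F -> tame G -> tame (mero_add F G).
Proof.
move=> [MF NF [d Fd dS]] [MG NG [d' Gd dS']]; split.
- exact: is_mero_add.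
- apply: upper_o_le (upper_o_add NF NG); exists 0 => r r0.
  have [FG|GF] := leP (mu abs r F) (mu abs r G).
    apply: le_trans (logp_le (mu_add_le Habs MF MG r0 FG (lexx _))) _.
    by rewrite lerDr logp_ge0.
  apply: le_trans (logp_le (mu_add_le Habs MF MG r0 (lexx _) (ltW GF))) _.
  by rewrite lerDl logp_ge0.
- exists (fun z => d z + d' z)%N; [exact: poles_le_add | exact: small_weight_add].
Qed.

Lemma tame_opp F : tame F -> tame (mero_opp F).
Proof.
move=> [MF NF [d Fd dS]]; split; first exact: is_mero_opp.
- by apply: upper_o_le NF; exists 0 => r _; rewrite /mprox mu_opp.
- by exists d => //; apply: poles_le_opp.
Qed.

Lemma tame_comp al be F : abs al = 1 -> tame F -> tame (mero_comp abs al be F).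
Proof.
move=> Hal [MF NF [d Fd dS]]; split; first exact: is_mero_comp.
- apply: upper_o_le NF; exists (Num.max 0 (abs be)) => r.
  by rewrite gt_max => /andP[r0 /ltW ber]; rewrite /mprox mu_comp_aff.
- by exists (fun z => d (al * z + be)); [apply: poles_le_comp | apply: small_weight_comp].
Qed.

Lemma tame0 : tame (mero0 K).
Proof.
split; first exact: is_mero0.
- apply: upper_o_le (upper_o_const 0); exists 0 => r _.
  by rewrite /mprox mu_mero0 // /logp (ln0 (lexx 0)) max_l.
- exists (fun=> 0%N); [exact: poles_le0 | exact: small_weight0].
Qed.

Lemma tame1 : tame (mero1 K).
Proof.
split; first exact: is_mero1.
- apply: upper_o_le (upper_o_const 0); exists 0 => r r0.
  by rewrite /mprox mu_mero1 // /logp ln1 max_l.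
- exists (fun=> 0%N); [exact: poles_le1 | exact: small_weight0].
Qed.

Lemma tame_delta_iter al be j F : abs al = 1 -> tame F ->
  tame (mero_delta_iter abs al be j F).
Proof.
move=> Hal TF; elim: j => [//|j IH]; rewrite /mero_delta_iter iterS.
by apply: tame_add; [apply: tame_comp | apply: tame_opp].
Qed.

Lemma tame_pow F k : tame F -> tame (mero_pow F k).
Proof. by move=> TF; elim: k => [|k IH]; [exact: tame1 | apply: tame_mul]. Qed.

Lemma tame_poly_eval m (I : finType) (c : I -> mero K) (e : I -> 'I_m.+1 -> nat)
    (X : 'I_m.+1 -> mero K) :
  (forall i, tame (c i)) -> (forall k, tame (X k)) -> tame (poly_eval c e X).
Proof.
move=> Tc TX; rewrite /poly_eval; elim/big_ind: _ => [|F G|i _].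
- exact: tame0.
- exact: tame_add.
apply: tame_mul => //; elim/big_ind: _ => [|F G|k _].
- exact: tame1.
- exact: tame_mul.
- exact: tame_pow.
Qed.

(** Jensen's inequality bounds m(r, 1/F) by the counting function of the weight plus a constant, and
    both are negligible. *)
Lemma tame_inv_le F : tame F -> ~ mero_eq0 F -> upper_o (fun r => mprox abs r (mero_inv F)).
Proof.
move=> [MF _ [d Fd [_ dS]]] F0.
have F10 : F.1 <> ps0 K by move=> E; apply: F0 => n; rewrite E.
have [C HC] := poles_le_lower Habs Hcomplete MF F10 Fd.
have [F1 F2 _] := MF; have [n Fn] := ps_neq0 F10.
move=> e e0; have e20 : 0 < e / 2 by rewrite divr_gt0.
have [r0 H] := eventually_and (eventually_and (dS _ e20) (T_const_le C e20))
  (eventually_and (T_const_le 0 e0) (eventually_gt 1)).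
exists r0 => r /H[[HX HY] [T0 /ltW r1]].
have r00 : 0 < r by apply: lt_le_trans r1.
rewrite /mprox /logp ge_max T0 /mu /= ln_div ?posrE ?(mu_ps_gt0 Habs F1 r00 Fn) ?mu_den_gt0 //.
have [s [us sr Hs]] := HC r r1; apply: le_trans Hs _.
rewrite (_ : e * T r = e / 2 * T r + e / 2 * T r); last by field.
by rewrite lerD ?HX.
Qed.

End Tame.

(** * Perturbation of a difference polynomial *)

Section Perturbation.
Variables (K : closedFieldType) (R : realType) (abs : K -> R).
Hypotheses (Habs : nonarch_abs abs) (Hcomplete : completeK abs).
Implicit Types (F G : mero K) (r B D : R).

(* The quantitative congruence [F = G mod D]; the factor [B] makes it stable
   under products. *)
Definition near_mero r B D F G :=
  [/\ is_mero abs F, is_mero abs G &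
   [/\ mu abs r F <= B, mu abs r G <= B & mu abs r (mero_sub F G) <= B * D]].

Lemma is_mero_sub F G : is_mero abs F -> is_mero abs G -> is_mero abs (mero_sub F G).
Proof. by move=> MF MG; apply: is_mero_add => //; apply: is_mero_opp. Qed.

(** The norm depends only on the function, not on the chosen quotient; algebraic identities thus
    need checking only after cross-multiplication, by [ring] in [fps]. *)
Lemma mu_eq r F G : is_mero abs F -> is_mero abs G -> 0 < r ->
  mero_eq F G -> mu abs r F = mu abs r G.
Proof.
move=> MF MG r0 /funext FG; have [F1 F2 _] := MF; have [G1 G2 _] := MG.
have nF := lt0r_neq0 (mu_den_gt0 Habs MF r0).
have nG := lt0r_neq0 (mu_den_gt0 Habs MG r0).
apply/eqP; rewrite /mu eqr_div //.
by rewrite -!(mu_psM Habs) // FG.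
Qed.

Lemma near_mero_refl r D F : is_mero abs F -> 0 < r -> 0 <= D ->
  near_mero r (mu abs r F) D F F.
Proof.
move=> MF r0 D0; split=> //; split=> //.
suff -> : mu abs r (mero_sub F F) = 0 by apply: mulr_ge0 => //; apply: mu_ge0.
rewrite /mu /= (_ : ps_add _ _ = ps0 K) ?(mu_ps0 Habs) ?mul0r //.
by apply/funext => n; rewrite ps_mulNl /ps_add /ps_opp subrr.
Qed.

Lemma near_meroW r B B' D F G : 0 <= D -> B <= B' -> near_mero r B D F G ->
  near_mero r B' D F G.
Proof.
move=> D0 BB [MF MG [FB GB FGB]]; split=> //; split.
- exact: le_trans BB.
- exact: le_trans BB.
- by apply: le_trans FGB _; apply: ler_wpM2r.
Qed.

Lemma near_mero_mul r B B' D F F' G G' : 0 < r -> 0 <= B -> 0 <= B' -> 0 <= D ->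
  near_mero r B D F G -> near_mero r B' D F' G' ->
  near_mero r (B * B') D (mero_mul F F') (mero_mul G G').
Proof.
move=> r0 B0 B0' D0 [MF MG [FB GB FGB]] [MF' MG' [FB' GB' FGB']].
have MFF := is_mero_mul Habs MF MF'; have MGG := is_mero_mul Habs MG MG'.
have S1 := is_mero_sub MF MG; have S2 := is_mero_sub MF' MG'.
split=> //; rewrite !mu_mul //; split.
- by apply: ler_pM => //; apply: mu_ge0.
- by apply: ler_pM => //; apply: mu_ge0.
(* The product rule F F' - G G' = F (F' - G') + (F - G) G'. *)
rewrite (@mu_eq _ _ (mero_add (mero_mul F (mero_sub F' G')) (mero_mul (mero_sub F G) G'))) //.
- apply: mu_add_le => //; try exact: is_mero_mul.
    by rewrite mu_mul // -mulrA; apply: ler_pM => //; apply: mu_ge0.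
  rewrite mu_mul // (_ : B * B' * D = (B * D) * B'); last by ring.
  by apply: ler_pM => //; apply: mu_ge0.
- exact: is_mero_sub.
- by apply: is_mero_add => //; apply: is_mero_mul.
move=> n; congr (_ n); rewrite /=.
set f1 := F.1; set f2 := F.2; set g1 := G.1; set g2 := G.2.
set f1' := F'.1; set f2' := F'.2; set g1' := G'.1; set g2' := G'.2.
pose a := Fps f1; pose b := Fps f2; pose c := Fps g1; pose d := Fps g2.
pose a' := Fps f1'; pose b' := Fps f2'; pose c' := Fps g1'; pose d' := Fps g2'.
apply: (congr1 (@coefs K) (_ :
  (a * a' * (d * d') + - (c * c') * (b * b')) * (b * (b' * d') * (b * d * d')) =
  (a * (a' * d' + - c' * b') * (b * d * d') + ((a * d + - c * b) * c') * (b * (b' * d'))) *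
   (b * b' * (d * d')))).
ring.
Qed.

Lemma near_mero_add r B B' D F F' G G' : 0 < r -> 0 <= D ->
  near_mero r B D F G -> near_mero r B' D F' G' ->
  near_mero r (Num.max B B') D (mero_add F F') (mero_add G G').
Proof.
move=> r0 D0 N1 N2.
have {N1}[MF MG [FB GB FGB]] : near_mero r (Num.max B B') D F G.
  by apply: near_meroW N1 => //; rewrite le_max lexx.
have {N2}[MF' MG' [FB' GB' FGB']] : near_mero r (Num.max B B') D F' G'.
  by apply: near_meroW N2 => //; rewrite le_max lexx orbT.
have MFF := is_mero_add Habs MF MF'; have MGG := is_mero_add Habs MG MG'.
have S1 := is_mero_sub MF MG; have S2 := is_mero_sub MF' MG'.
split=> //; split; try exact: mu_add_le.
rewrite (@mu_eq _ _ (mero_add (mero_sub F G) (mero_sub F' G'))) //.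
- exact: mu_add_le.
- exact: is_mero_sub.
- exact: is_mero_add.
move=> n; congr (_ n); rewrite /=.
pose a := Fps F.1; pose b := Fps F.2; pose c := Fps G.1; pose d := Fps G.2.
pose a' := Fps F'.1; pose b' := Fps F'.2; pose c' := Fps G'.1; pose d' := Fps G'.2.
apply: (congr1 (@coefs K) (_ :
  ((a * b' + a' * b) * (d * d') + - (c * d' + c' * d) * (b * b')) * (b * d * (b' * d')) =
  ((a * d + - c * b) * (b' * d') + (a' * d' + - c' * b') * (b * d)) * (b * b' * (d * d')))).
ring.
Qed.

Lemma near_mero_opp r B D F G : 0 < r ->
  near_mero r B D F G -> near_mero r B D (mero_opp F) (mero_opp G).
Proof.
move=> r0 [MF MG [FB GB FGB]]; have [NF NG] := (is_mero_opp Habs MF, is_mero_opp Habs MG).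
split=> //; rewrite !mu_opp //; split=> //.
rewrite (@mu_eq _ _ (mero_opp (mero_sub F G))) ?mu_opp //.
- exact: is_mero_sub.
- by apply: is_mero_opp => //; apply: is_mero_sub.
move=> n; congr (_ n); rewrite /=.
pose a := Fps F.1; pose b := Fps F.2; pose c := Fps G.1; pose d := Fps G.2.
apply: (congr1 (@coefs K) (_ :
  ((- a) * d + - (- c) * b) * (b * d) = - (a * d + - c * b) * (b * d))).
ring.
Qed.

Lemma near_mero_comp al be r B D F G : abs al = 1 -> 0 < r -> abs be <= r ->
  near_mero r B D F G -> near_mero r B D (mero_comp abs al be F) (mero_comp abs al be G).
Proof.
move=> Hal r0 ber [MF MG [FB GB FGB]].
have CF := is_mero_comp Habs Hcomplete be Hal MF.
have CG := is_mero_comp Habs Hcomplete be Hal MG.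
have [[F1 F2 _] [G1 G2 _]] := (MF, MG).
split=> //; rewrite !mu_comp_aff //; split=> //.
have -> : mero_sub (mero_comp abs al be F) (mero_comp abs al be G) =
    mero_comp abs al be (mero_sub F G).
  rewrite /mero_sub /mero_add /mero_comp /=; congr pair.
    rewrite comp_add ?comp_mul ?comp_opp //; try apply: ps_mul_entire => //;
    exact: ps_opp_entire.
  by rewrite comp_mul.
by rewrite mu_comp_aff //; apply: is_mero_sub.
Qed.

(** Substitution is isometric and a difference costs only a maximum, so [B] does not grow with
    [j]. *)
Lemma near_mero_delta_iter al be j r B D F G : abs al = 1 -> 0 < r -> abs be <= r ->
  0 <= D -> near_mero r B D F G ->
  near_mero r B D (mero_delta_iter abs al be j F) (mero_delta_iter abs al be j G).
Proof.
move=> Hal r0 ber D0 N; elim: j => [//|j IH]; rewrite /mero_delta_iter !iterS.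
rewrite -[B](maxxx B); apply: near_mero_add => //; first exact: near_mero_comp.
exact: near_mero_opp.
Qed.

Lemma near_mero_pow k r B D F G : 0 < r -> 0 <= B -> 0 <= D ->
  near_mero r B D F G -> near_mero r (B ^+ k) D (mero_pow F k) (mero_pow G k).
Proof.
move=> r0 B0 D0 N; elim: k => [|k IH].
  by rewrite expr0 -(mu_mero1 Habs r0); apply: near_mero_refl => //; apply: is_mero1.
by rewrite exprS; apply: near_mero_mul => //; apply: exprn_ge0.
Qed.

Lemma near_mero_poly_eval m (I : finType) (c : I -> mero K) (e : I -> 'I_m.+1 -> nat)
    (X Y : 'I_m.+1 -> mero K) r (B : 'I_m.+1 -> R) D : 0 < r -> 0 <= D ->
  (forall i, is_mero abs (c i)) -> (forall k, 0 <= B k) ->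
  (forall k, near_mero r (B k) D (X k) (Y k)) ->
  near_mero r (\big[Num.max/0]_i (mu abs r (c i) * \prod_(k < m.+1) B k ^+ e i k)) D
    (poly_eval c e X) (poly_eval c e Y).
Proof.
move=> r0 D0 Mc B0 N; rewrite /poly_eval.
elim/big_rec3: _ => [|i F G z _ IH].
  by rewrite -(mu_mero0 Habs r); apply: near_mero_refl => //; apply: is_mero0.
apply: near_mero_add => //.
have P0 : 0 <= \prod_(k < m.+1) B k ^+ e i k by apply: prodr_ge0 => k _; rewrite exprn_ge0.
apply: near_mero_mul => //; [exact: mu_ge0 | exact: near_mero_refl |].
suff [] : 0 <= \prod_(k < m.+1) B k ^+ e i k /\
  near_mero r (\prod_(k < m.+1) B k ^+ e i k) D
  (\big[@mero_mul K/mero1 K]_(k < m.+1) mero_pow (X k) (e i k))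
  (\big[@mero_mul K/mero1 K]_(k < m.+1) mero_pow (Y k) (e i k)) by [].
elim/big_rec3: _ => [|k F' G' z' _ [IH0 IH']].
  split; rewrite ?ler01 // -(mu_mero1 Habs r0).
  by apply: near_mero_refl => //; apply: is_mero1.
split; first by rewrite mulr_ge0 ?exprn_ge0.
by apply: near_mero_mul => //; [rewrite exprn_ge0 | apply: near_mero_pow].
Qed.

Lemma near_mero_zero r B D F G : 0 < r -> mero_eq0 F -> near_mero r B D F G ->
  mu abs r G <= B * D.
Proof.
move=> r0 /funext F0 [MF MG [_ _]]; apply: le_trans.
have [[F1 F2 _] [G1 G2 _]] := (MF, MG).
have mF := mu_den_gt0 Habs MF r0; have mG := mu_den_gt0 Habs MG r0.
rewrite /mu /= F0 ps_mulNl (_ : ps_add _ _ = ps_opp (ps_mul G.1 F.2)); last first.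
  apply/funext => n; rewrite /ps_add /ps_mul big1 ?add0r // => i _.
  by rewrite mul0r.
rewrite (mu_psN Habs) !(mu_psM Habs) // [_ F.2 * _]mulrC -mulf_div divff ?mulr1 //.
by rewrite gt_eqF.
Qed.

End Perturbation.

(** * Factors with negligible logarithm *)

Section LogBounds.
Variables (R : realType) (T : R -> R).
Hypothesis T_unbounded : forall M, exists r0, forall r, r0 < r -> M <= T r.
Implicit Types X Y : R -> R.

(** Eventual non-negativity is included because [logpM] requires it of both factors. *)
Definition logp_upper_o X :=
  (exists r0, forall r, r0 < r -> 0 <= X r) /\ upper_o T (fun r => logp (X r)).

Lemma logp_upper_o1 : logp_upper_o (fun=> 1).
Proof.
split; first by exists 0.
by rewrite /logp ln1 maxxx; apply: upper_o_const.
Qed.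

Lemma logp_upper_o0 : logp_upper_o (fun=> 0).
Proof.
split; first by exists 0.
by rewrite /logp (ln0 (lexx 0)) maxxx; apply: upper_o_const.
Qed.

Lemma logp_upper_o_mul X Y : logp_upper_o X -> logp_upper_o Y ->
  logp_upper_o (fun r => X r * Y r).
Proof.
move=> [X0 NX] [Y0 NY]; have [r0 H] := eventually_and X0 Y0; split.
  by exists r0 => r /H[? ?]; apply: mulr_ge0.
by apply: upper_o_le (upper_o_add NX NY); exists r0 => r /H[? ?]; apply: logpM.
Qed.

Lemma logp_upper_o_max X Y : logp_upper_o X -> logp_upper_o Y ->
  logp_upper_o (fun r => Num.max (X r) (Y r)).
Proof.
move=> [X0 NX] [Y0 NY]; have [r0 H] := eventually_and X0 Y0; split.
  by exists r0 => r /H[? ?]; rewrite le_max; apply/orP; left.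
apply: upper_o_le (upper_o_add NX NY); exists r0 => r _.
by have [_|_] := leP (X r) (Y r); rewrite ?lerDl ?lerDr logp_ge0.
Qed.

Lemma logp_upper_o_pow X k : logp_upper_o X -> logp_upper_o (fun r => X r ^+ k).
Proof.
move=> NX; elim: k => [|k IH]; first exact: logp_upper_o1.
under eq_fun do rewrite exprS; exact: logp_upper_o_mul.
Qed.

Lemma logp_upper_o_prod (J : Type) (s : seq J) (F : J -> R -> R) :
  (forall j, logp_upper_o (F j)) -> logp_upper_o (fun r => \prod_(j <- s) F j r).
Proof.
move=> NF; elim: s => [|j s IH].
  by under eq_fun do rewrite big_nil; exact: logp_upper_o1.
by under eq_fun do rewrite big_cons; exact: logp_upper_o_mul.
Qed.

Lemma logp_upper_o_bigmax (J : Type) (s : seq J) (F : J -> R -> R) :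
  (forall j, logp_upper_o (F j)) ->
  logp_upper_o (fun r => \big[Num.max/0]_(j <- s) F j r).
Proof.
move=> NF; elim: s => [|j s IH].
  by under eq_fun do rewrite big_nil; exact: logp_upper_o0.
by under eq_fun do rewrite big_cons; exact: logp_upper_o_max.
Qed.

End LogBounds.

(** From f = a + (f - a) with the difference of norm at most 1, the norm of [f] is at most max(1, mu
    r a): the constant involves [a] alone. *)
Lemma near_mero_self (K : closedFieldType) (R : realType) (abs : K -> R)
    (f a : mero K) r : nonarch_abs abs -> is_mero abs f -> is_mero abs a -> 0 < r ->
  mu abs r (mero_sub f a) <= 1 ->
  near_mero abs r (Num.max 1 (mu abs r a)) (mu abs r (mero_sub f a)) f a.
Proof.
move=> Habs Mf Ma r0 D1; have S := is_mero_sub Habs Mf Ma.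
have D0 := mu_ge0 Habs S r0.
split=> //; split.
- rewrite (@mu_eq _ _ _ Habs _ f (mero_add a (mero_sub f a))) //.
  + by apply: mu_add_le => //; rewrite le_max ?lexx ?orbT // D1.
  + exact: is_mero_add.
  move=> n; congr (_ n); rewrite /=.
  pose x := Fps f.1; pose y := Fps f.2; pose z := Fps a.1; pose t := Fps a.2.
  apply: (congr1 (@coefs K) (_ : x * (t * (y * t)) =
    (z * (y * t) + (x * t + - z * y) * t) * y)).
  ring.
- by rewrite le_max lexx orbT.
by rewrite ler_peMl // le_max lexx.
Qed.

Theorem theorem6p3 (K : closedFieldType) (R : realType) (abs : K -> R)
  (char0 : [pchar K] =i pred0)
  (Habs : nonarch_abs abs) (Hcomplete : completeK abs)
  (n : nat) (Hn : (0 < n)%N) (al be : 'I_n -> K)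
  (Hal : forall i, abs (al i) = 1)
  (HL : forall i, ~ (al i = 1 /\ be i = 0))
  (m : nat) (oi : 'I_m -> 'I_n) (oj : 'I_m -> nat) (Hoj : forall k, (0 < oj k)%N)
  (I : finType) (c : I -> mero K) (e : I -> 'I_m.+1 -> nat)
  (He : injective e)
  (Hc : forall i, is_mero abs (c i))
  (Hnz : exists i, ~ mero_eq0 (c i))
  (f : mero K) (Hf : is_mero abs f) (Hfnc : ~ mero_const f)
  (Hfeq : mero_eq0 (poly_eval c e (ops_vars abs al be oi oj f)))
  (Hadm : small_o (fun r => \sum_(i : I) Tchar abs r (c i)) (fun r => Tchar abs r f))
  (a : mero K) (Ha : is_mero abs a)
  (Hasmall : small_o (fun r => Tchar abs r a) (fun r => Tchar abs r f))
  (Hanz : ~ mero_eq0 (poly_eval c e (ops_vars abs al be oi oj a))) :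
  small_o (fun r => mprox abs r (mero_inv (mero_sub f a))) (fun r => Tchar abs r f).
Proof.
set T := fun r => Tchar abs r f.
have HT : forall M, exists r0, forall r, r0 < r -> M <= T r.
  exact: Tchar_unbounded.
have Tchar_ge0 F r : is_mero abs F -> 1 <= r -> 0 <= Tchar abs r F.
  by move=> MF r1; rewrite addr_ge0 ?logp_ge0 // Ncount_ge0.
have Tc i : tame abs T (c i).
  apply: tame_Tchar => // d d0; have [r0 H] := eventually_and (Hadm d d0) (eventually_gt 1).
  exists r0 => r /H[/(le_trans (ler_norm _)) Hs /ltW r1]; apply: le_trans Hs.
  by rewrite (bigD1 i) //= lerDl sumr_ge0 // => j _; apply: Tchar_ge0.
have Ta : tame abs T a.
  apply: tame_Tchar => // d d0; have [r0 H] := Hasmall d d0.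
  by exists r0 => r /H; apply: le_trans (ler_norm _).
pose Oa := poly_eval c e (ops_vars abs al be oi oj a).
have TOa : tame abs T Oa.
  apply: tame_poly_eval => // k; rewrite /ops_vars; case: unliftP => [j _|_] //.
  exact: tame_delta_iter.
have [MOa _ _] := TOa.
have NOa := tame_inv_le Habs Hcomplete HT TOa Hanz.
pose B r := Num.max 1 (mu abs r a).
pose BB r := \big[Num.max/0]_i (mu abs r (c i) * \prod_(k < m.+1) B r ^+ e i k).
have tame_log F : tame abs T F -> logp_upper_o T (fun r => mu abs r F).
  by move=> [MF NF _]; split=> //; exists 0 => r; apply: mu_ge0.
have NBB : logp_upper_o T BB.
  apply: logp_upper_o_bigmax => // i; apply: logp_upper_o_mul; first exact: tame_log.
  apply: logp_upper_o_prod => // k; apply: logp_upper_o_pow => //.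
  by apply: logp_upper_o_max; [exact: logp_upper_o1 | exact: tame_log].
have [BB0 NBB'] := NBB.
move=> d d0; have [r0 H] := eventually_and (eventually_and BB0 (upper_o_add NBB' NOa d0))
  (eventually_and (T_const_le HT 0 d0)
  (eventually_and (eventually_gt 1) (eventually_gt (\big[Num.max/0]_i abs (be i))))).
exists r0 => r /H[[BBr Nr] [T0 [r1 ber]]].
have r00 : 0 < r by apply: lt_trans r1.
have bei i : abs (be i) <= r by apply: le_trans (ltW ber); apply: le_bigmax.
rewrite ger0_norm ?logp_ge0 // /mprox.
set D := mu abs r (mero_sub f a).
have MS := is_mero_sub Habs Hf Ha; have D0 : 0 <= D := mu_ge0 Habs MS r00.
have mu_inv F : mu abs r (mero_inv F) = (mu abs r F)^-1 by rewrite /mu invf_div.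
(* For D > 1 the norm of 1 / (f - a) is below 1, so its proximity function is 0. *)
rewrite mu_inv -/D; have [D1|D1] := ltP 1 D.
  by rewrite /logp ge_max T0 (le_trans _ T0) // lnV ?posrE ?(lt_trans ltr01) // oppr_le0 ln_ge0 // ltW.
(* The conventions [0^-1 = 0] and [ln 0 = 0] make the left-hand side 0 here. *)
have [Dz|Dn0] := eqVneq D 0; first by rewrite Dz invr0 /logp (ln0 (lexx 0)) maxxx.
have Dpos : 0 < D by rewrite lt_def Dn0.
have near_fa := near_mero_self Habs Hf Ha r00 D1.
have OaD : mu abs r Oa <= BB r * D.
  apply: (near_mero_zero Habs r00 Hfeq); apply: near_mero_poly_eval => //.
    by move=> k; rewrite le_max ler01.
  move=> k; rewrite /ops_vars; case: unliftP => [j _|_] //.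
  exact: near_mero_delta_iter.
have Oa0 : 0 < mu abs r Oa.
  have [E1 _ _] := MOa; have [k kP] : exists k, Oa.1 k != 0.
    by apply: ps_neq0 => O0; apply: Hanz => k; rewrite -/Oa O0.
  by rewrite divr_gt0 ?(mu_ps_gt0 Habs E1 r00 kP) ?mu_den_gt0.
(* Rearranging [OaD], 1 / D is at most [BB r] times the inverse of the norm of [Oa], and both
   factors have negligible logarithm. *)
apply: le_trans Nr; rewrite /mprox mu_inv.
apply: le_trans (logpM BBr _); last by rewrite invr_ge0 ltW.
by apply: logp_le; rewrite ler_pdivlMr // ler_pdivrMl // mulrC.
Qed.
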